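(* Let $G$ be a (finite, simple) plane graph with minimum degree five. Then $G$ contains at least one of the following minor $5$-stars: $\langle 5,7,7,5,17\rangle$, $\langle 5,7,8,5,11\rangle$, $\langle 5,7,5,8,8\rangle$, $\langle 8,5,5,11,6\rangle$, $\langle 8,5,5,8,7\rangle$, $\langle 8,5,5,7,8\rangle$, $\langle 8,5,5,6,9\rangle$, $\langle 5,6,5,8,11\rangle$, $\langle 5,6,6,5,\infty\rangle$, $\langle 5,6,6,6,17\rangle$, $\langle 6,6,6,6,11\rangle$, $\langle 6,6,6,7,8\rangle$, $\langle 6,6,7,6,8\rangle$, $\langle 5,6,6,11,7\rangle$, $\langle 5,6,11,6,7\rangle$, $\langle 5,6,6,8,8\rangle$, $\langle 5,6,8,6,8\rangle$, $\langle 5,7,6,8,7\rangle$, $\langle 5,6,7,7,7\rangle$, $\langle 5,6,6,7,11\rangle$, $\langle 5,6,7,6,11\rangle$, $\langle 5,7,6,7,8\rangle$, $\langle 5,7,7,6,8\rangle$, $\langle 5,7,6,6,14\rangle$, $\langle 5,8,6,6,11\rangle$, $\langle 5,5,7,6,14\rangle$, $\langle 5,6,7,5,35\rangle$, $\langle 5,6,8,5,15\rangle$, $\langle 5,6,9,5,10\rangle$, $\langle 5,6,11,5,9\rangle$, $\langle 5,5,10,5,12\rangle$, $\langle 5,7,11,5,8\rangle$, $\langle 5,6,5,7,14\rangle$, $\langle 5,5,9,5,17\rangle$.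
   Context: A plane graph is a graph embedded in the plane without edge crossings; $\deg(v)$ denotes the degree of $v$ in $G$. For integers (or $\infty$) $\kappa_1,\dots,\kappa_5$, a $\langle \kappa_1,\kappa_2,\kappa_3,\kappa_4,\kappa_5\rangle$-star in $G$ is a vertex $v$ of degree exactly $5$ together with its five neighbors $v_1,\dots,v_5$, listed in the cyclic order around $v$ given by the embedding (starting at some neighbor, in either orientation), such that $\deg(v_i)\le \kappa_i$ for $i=1,\dots,5$; the entry $\infty$ means no restriction. A star is called minor if its center has degree at most five; a minor $5$-star is thus a $5$-vertex together with its five neighbors. *)

(* Defs.v *)
(* MathComp-Analysis *)
From HB Require Import structures.
From mathcomp Require Import all_boot all_order all_algebra.
From mathcomp Require Import all_classical all_reals all_analysis.
Set Implicit Arguments.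
Unset Strict Implicit.
Unset Printing Implicit Defensive.
Import Order.TTheory GRing.Theory Num.Theory.
Import numFieldNormedType.Exports.
Local Open Scope classical_set_scope.
Local Open Scope ring_scope.

(* A drawing of a finite simple graph in the plane R * R: the edge joining the
   adjacent vertices x and y is the simple arc traced on [0, 1] by edge_arc x y, and
   by edge_arc y x in the opposite direction.  The values of edge_arc x y for
   non-adjacent x and y are irrelevant. *)
Record plane_graph (R : realType) (T : finType) := PlaneGraph {
  adj : rel T;
  pos : T -> R * R;
  edge_arc : T -> T -> R -> R * R;
  adj_sym : symmetric adj;
  adj_irr : irreflexive adj;
  pos_inj : injective pos;
  arc_continuous : forall x y, adj x y ->
    {within `[0, 1], continuous (edge_arc x y)};
  arc_inj : forall x y, adj x y -> {in `[0, 1] &, injective (edge_arc x y)};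
  arc_start : forall x y, adj x y -> edge_arc x y 0 = pos x;
  arc_end : forall x y, adj x y -> edge_arc x y 1 = pos y;
  arc_rev : forall x y, adj x y ->
    {in `[0, 1], forall t, edge_arc y x t = edge_arc x y (1 - t)};
  arc_vertex : forall x y z, adj x y ->
    {in `]0, 1[, forall t, edge_arc x y t <> pos z};
  arc_nocross : forall x y z w, adj x y -> adj z w ->
    {in `]0, 1[ &, forall s t, edge_arc x y s = edge_arc z w t ->
       (z, w) = (x, y) \/ (z, w) = (y, x)}
}.

Section Stars.
Variables (R : realType) (T : finType) (G : plane_graph R T).

Definition deg (x : T) : nat := #|adj G x|.

Definition min_degree (d : nat) : Prop :=
  (forall x, (d <= deg x)%N) /\ (exists x, deg x = d).

(* Point of polar angle a on the Euclidean circle of centre c and radius r. *)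
Definition circle_point (c : R * R) (r a : R) : R * R :=
  (c.1 + r * cos a, c.2 + r * sin a).

Definition first_hit (g : R -> R * R) (c : R * R) (r a : R) : Prop :=
  exists t : R, [/\ 0 <= t <= 1, g t = circle_point c r a &
    forall s b : R, 0 <= s < t -> g s <> circle_point c r b].

(* The cyclic order of arcs leaving x is that of their first points on a small
   circle around x.  Arcs need not have a tangent at x, hence no initial
   direction; but the initial pieces inside the circle meet only at x, and this
   order does not depend on the circle as long as it encloses no neighbour of
   x. *)
Definition counterclockwise (n : nat) (x : T) (v : 'I_n -> T) : Prop :=
  \forall r \near 0^'+, exists a : 'I_n -> R,
    [/\ forall i, first_hit (edge_arc G x (v i)) (pos G x) r (a i),
        forall i j : 'I_n, (i < j)%N -> a i < a j &
        forall i j : 'I_n, a j < a i + 2 * pi].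

Definition cyclic_order (n : nat) (x : T) (v : 'I_n -> T) : Prop :=
  counterclockwise x v \/ counterclockwise x (fun i => v (rev_ord i)).

End Stars.

Inductive bound : Type := AtMost of nat | Infty.

Coercion AtMost : nat >-> bound.

Definition deg_le (d : nat) (k : bound) : Prop :=
  if k is AtMost m then (d <= m)%N else True.

Definition has_star (R : realType) (T : finType) (G : plane_graph R T)
    (k1 k2 k3 k4 k5 : bound) : Prop :=
  exists (x : T) (v : 'I_5 -> T),
    [/\ deg G x = 5%N, injective v, forall i, adj G x (v i),
        cyclic_order G x v &
        forall i : 'I_5, deg_le (deg G (v i)) (tnth [tuple k1; k2; k3; k4; k5] i)].

(* Main.v *)
(* Topology enters through a single identity.  For arcs e, g of the drawing, the
   boundary of the square carries no total turning of F(s, t) = e(t) - g(s), since F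
   vanishes at most at the corners where e and g share an endpoint.  Cutting those
   corners along the first hits of a small circle makes their contribution
   pi - (angle from g to e).  This yields both that the cyclic order of first hits
   does not depend on the circle and, after summing over darts, that every closed
   walk through faces and across edges meets the edges in a potential difference of
   vertices.  Linear algebra then gives E - F <= V - 1 for the faces F of the
   rotation system.

   Discharging: a vertex of degree d has charge d - 6, a corner in a face of length
   at least 4 has charge 1/2.  A vertex of degree at least 7 gives to its 5-neighbours,
   in general (d - 6)/d per corner, shared between the 5-vertices next to that corner;
   degrees 7, 11 and 13 use finer amounts, bounded by a maximal closed walk around the
   vertex (the parity of the degree matters there).  Finally the vertices of types
   (5,5,8,5,18+), (5,5,10,5,13) and (5,5,10,5,14) claim what they miss from a
   neighbouring 5-vertex. *)
From HB Require Import structures.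
From Stdlib Require Import ZArith.
Require Import Defs.
From mathcomp Require Import all_boot all_order all_algebra ssrZ zify.
From mathcomp Require Import all_classical all_reals all_analysis.
From mathcomp Require Import ring lra.

Set Implicit Arguments.
Unset Strict Implicit.
Unset Printing Implicit Defensive.
Local Delimit Scope Z_scope with ZZ.
Import Order.TTheory GRing.Theory Num.Theory.
Import numFieldNormedType.Exports.

(** Let V, E, F count vertices, edges and face walks. The sum of d - 6 over the vertices plus the
    sum of 2k - 6 over the lengths k of the face walks is -6(V - E + F), hence negative as soon as V
    - E + F is positive. Moreover 2k - 6 vanishes for k = 3 and is at least k/2 for larger k, with
    equality at k = 4: this is the origin of the 1/2 per corner. So a one-sided form of Euler's
    formula suffices, and the discharging runs on an abstract rotation system, without the plane.
    The scale 240240 = 16 * 3 * 5 * 7 * 11 * 13 makes (d - 6)/d and its half integral for the least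
    degree d >= 6 of every class. All local conditions are finite: a 5-vertex is a tuple of five
    classes with five corner flags, and a vertex of degree 7, 11 or 13 is a closed walk of that
    length on 19 states. Both are settled by evaluation. *)

(** * Charges *)

(* Charges are integers, 240240 standing for 1. *)
Definition unit_charge : Z := 240240.
Definition half_unit : Z := 120120.

Definition nthZ (s : seq Z) (i : nat) : Z := nth 0%ZZ s i.

(* Degrees are grouped in classes 0, ..., 13, with least elements 5, ..., 16, 18, 36: the
   stars of the theorem do not distinguish degrees within a class.  The charge
   (d - 6)/d of a corner is taken at the least element d. *)
Definition corner_charge (c : nat) : Z := nthZ [:: 0; 0; 34320; 60060; 80080; 96096; 109200;
  120120; 129360; 137280; 144144; 150150; 160160; 200200]%ZZ c.
Definition half_corner_charge (c : nat) : Z := nthZ [:: 0; 0; 17160; 30030; 40040; 48048; 54600;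
  60060; 64680; 68640; 72072; 75075; 80080; 100100]%ZZ c.

(* The classes of the degrees 7, 11 and 13. *)
Definition special (c : nat) : bool := [|| c == 2, c == 6 | c == 8].

Definition by_special (x y z : Z) (c : nat) : Z :=
  if c == 2 then x else if c == 6 then y else z.

(* What a vertex of degree 7, 11 or 13 gives to a 5-neighbour having on both, one or no
   side a 5-vertex or a face of length at least 4; side and opposite refer to the position
   of a face of length at least 4 that is at the 5-vertex only. *)
Definition both_charge := by_special 40040 120120 129360.
Definition one_charge := by_special 40040 120120 170170.
Definition iso_charge := by_special 80080 218400 258720.
Definition side_charge := by_special 20020 60060 100100.
Definition opposite_charge := by_special 0 0 72072.

Definition one_sided (c : nat) : Z :=
  if special c then one_charge c else (corner_charge c + half_corner_charge c)%ZZ.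

(** Two 5-vertices at a triangular corner halve its charge. A corner outside the triangles brings
    1/2 more to the sender, so both its neighbours can receive all of [corner_charge] as long as
    this is at most 1/2, that is for [c <= 7] (degree at most 12). The other neighbour at such a
    corner is not looked at, since it need not be adjacent to the receiver. *)
Definition corner_share (c : nat) (b : bool) (x : nat) : Z :=
  if (if b then x == 0 else 7 < c) then half_corner_charge c else corner_charge c.

(** If the two opposite neighbours both have degree above 5, the sender adds just what they leave
    missing. Degree 13 is fitted to parity: 12 * 134134 + 72072 is its whole charge of 7 units, and
    134134 + 96096, the latter from degree 10, falls short of one unit by the 10010 that is claimed.
    Two senders of degree 13 give 2 * 130130 = 240240 + 2 * 10010, which covers two claims to be
    paid. *)
Definition both_demand (c c2 c3 : nat) : Z :=
  if (0 < c2) && (0 < c3) then Z.max 0 (unit_charge - one_sided c2 - one_sided c3)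
  else if (c == 8) && (maxn c2 c3 == 5) then 134134%ZZ
  else if (c == 8) && (maxn c2 c3 == 8) then 130130%ZZ
  else both_charge c.

(** The exceptional values complete the unit for the neighbour degrees (11,5,10,5,6) and
    (13,5,8,5,6): 144144 + 96096 and 180180 + 60060. *)
Definition one_demand (c t s x : nat) : Z :=
  if [&& c == 6, t == 5, s == 0 & x == 1] then 144144%ZZ
  else if [&& c == 8, t == 3, s == 0 & x == 1] then 180180%ZZ
  else one_charge c.

(* The charge sent along a dart from a 5-vertex u back to u.  Here c0, ..., c4 are the
   classes of the neighbours of u in cyclic order from the sender, and bi tells whether the
   corner between the neighbours i and i + 1 lies in a triangle. *)
Definition demand (c0 c1 c2 c3 c4 : nat) (b0 b1 b2 b3 b4 : bool) : Z :=
  if special c0 then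
    let f1 := (c1 == 0) || ~~ b0 in
    let f4 := (c4 == 0) || ~~ b4 in
    let t := [&& b0, b1, b2, b3 & b4] in
    if f1 then
      if f4 then
        if t then both_demand c0 c2 c3
        else if ~~ b0 || ~~ b4 then both_charge c0
        else if ~~ b1 || ~~ b3 then side_charge c0
        else opposite_charge c0
      else if t then one_demand c0 c2 c3 c4 else one_charge c0
    else if f4 then (if t then one_demand c0 c3 c2 c1 else one_charge c0)
    else iso_charge c0
  else (corner_share c0 b0 c1 + corner_share c0 b4 c4)%ZZ.

(** The exact deficit when the only givers are [L] and [k], which give 160160 + 60060, 134134 +
    96096 and 137280 + 96096 respectively. *)
Definition claim_amount (L k : nat) : Z :=
  if (L == 12) && (k == 3) then 20020%ZZ
  else if (L == 8) && (k == 5) then 10010%ZZ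
  else if (L == 9) && (k == 5) then 6864%ZZ else 0%ZZ.

(* A 5-vertex with neighbours L, u', t, k, s, where u', t, s are 5-vertices, claims from t,
   or from u' if t has itself neighbours (k, 5, 5, p, 5) inside triangles. *)
Definition claim (c0 c1 c2 c3 c4 : nat) (b0 b1 b2 b3 b4 : bool) : Z :=
  if [&& b0, b1, b2, b3, b4, c1 == 0, c2 == 0 & c4 == 0] then claim_amount c0 c3 else 0%ZZ.

(* Bounds for the claims that a 5-vertex has to pay as t and as u', respectively. *)
Definition near_cost (c0 c1 c2 c3 c4 : nat) (b0 b1 b2 b3 b4 : bool) : Z :=
  if [&& c1 == 0, c2 == 0 & (0 < c4) || ~~ b2] then
    if c0 == 3 then 20020%ZZ else if c0 == 5 then 10010%ZZ else 0%ZZ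
  else 0%ZZ.

Definition far_cost (c0 c1 c2 c3 c4 : nat) (b0 b1 b2 b3 b4 : bool) : Z :=
  if [&& c1 == 0, c2 == 0 & 8 <= c3] then
    if c0 == 12 then 20020%ZZ else if c0 == 8 then 10010%ZZ else if c0 == 9 then 6864%ZZ else 0%ZZ
  else 0%ZZ.

Definition mirror (A : Type) (f : nat -> nat -> nat -> nat -> nat ->
    bool -> bool -> bool -> bool -> bool -> A) c0 c1 c2 c3 c4 b0 b1 b2 b3 b4 :=
  f c0 c4 c3 c2 c1 b4 b3 b2 b1 b0.

Definition net_gain (c0 c1 c2 c3 c4 : nat) (b0 b1 b2 b3 b4 : bool) : Z :=
  (demand c0 c1 c2 c3 c4 b0 b1 b2 b3 b4 + (if b0 then 0 else half_unit)
  + claim c0 c1 c2 c3 c4 b0 b1 b2 b3 b4 + mirror claim c0 c1 c2 c3 c4 b0 b1 b2 b3 b4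
  - near_cost c0 c1 c2 c3 c4 b0 b1 b2 b3 b4 - mirror near_cost c0 c1 c2 c3 c4 b0 b1 b2 b3 b4
  - far_cost c0 c1 c2 c3 c4 b0 b1 b2 b3 b4 - mirror far_cost c0 c1 c2 c3 c4 b0 b1 b2 b3 b4)%ZZ.

Definition balance (c0 c1 c2 c3 c4 : nat) (b0 b1 b2 b3 b4 : bool) : Z :=
  (net_gain c0 c1 c2 c3 c4 b0 b1 b2 b3 b4 + net_gain c1 c2 c3 c4 c0 b1 b2 b3 b4 b0
   + net_gain c2 c3 c4 c0 c1 b2 b3 b4 b0 b1 + net_gain c3 c4 c0 c1 c2 b3 b4 b0 b1 b2
   + net_gain c4 c0 c1 c2 c3 b4 b0 b1 b2 b3)%ZZ.

(* The stars of the theorem, each entry replaced by its class. *)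
Definition stars : seq (nat * nat * nat * nat * nat) := [::
  (0,2,2,0,11); (0,2,3,0,6); (0,2,0,3,3); (3,0,0,6,1); (3,0,0,3,2); (3,0,0,2,3);
  (3,0,0,1,4); (0,1,0,3,6); (0,1,1,0,13); (0,1,1,1,11); (1,1,1,1,6); (1,1,1,2,3);
  (1,1,2,1,3); (0,1,1,6,2); (0,1,6,1,2); (0,1,1,3,3); (0,1,3,1,3); (0,2,1,3,2);
  (0,1,2,2,2); (0,1,1,2,6); (0,1,2,1,6); (0,2,1,2,3); (0,2,2,1,3); (0,2,1,1,9);
  (0,3,1,1,6); (0,0,2,1,9); (0,1,2,0,12); (0,1,3,0,10); (0,1,4,0,5); (0,1,6,0,4);
  (0,0,5,0,7); (0,2,6,0,3); (0,1,0,2,9); (0,0,4,0,11)].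

Definition below (s : nat * nat * nat * nat * nat) (c0 c1 c2 c3 c4 : nat) : bool :=
  let: (s0, s1, s2, s3, s4) := s in
  [&& c0 <= s0, c1 <= s1, c2 <= s2, c3 <= s3 & c4 <= s4].

Definition rotations_below s c0 c1 c2 c3 c4 : bool :=
  [|| below s c0 c1 c2 c3 c4, below s c1 c2 c3 c4 c0, below s c2 c3 c4 c0 c1,
      below s c3 c4 c0 c1 c2 | below s c4 c0 c1 c2 c3].

Definition covered c0 c1 c2 c3 c4 : bool :=
  has (fun s => rotations_below s c0 c1 c2 c3 c4 || rotations_below s c0 c4 c3 c2 c1) stars.

(** * The finite check of the neighbourhoods of a 5-vertex *)

Definition all_masks (p : bool -> bool -> bool -> bool -> bool -> bool) : bool :=
  let l := [:: true; false] in
  all (fun b0 => all (fun b1 => all (fun b2 => all (fun b3 => all (p b0 b1 b2 b3) l) l) l) l) l.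

Definition low_demand (c : nat) : Z :=
  if special c then opposite_charge c else corner_charge c.

(** The flag [false] in third place opens the guard of [near_cost], so that this is an upper bound
    for all flags. *)
Definition side_cost c0 c1 c2 c3 c4 : Z :=
  (near_cost c0 c1 c2 c3 c4 true true false true true
   + far_cost c0 c1 c2 c3 c4 true true true true true)%ZZ.
Definition vertex_cost c0 c1 c2 c3 c4 : Z :=
  (side_cost c0 c1 c2 c3 c4 + side_cost c0 c4 c3 c2 c1)%ZZ.
Definition max_cost c0 c1 c2 c3 c4 : Z :=
  (vertex_cost c0 c1 c2 c3 c4 + vertex_cost c1 c2 c3 c4 c0 + vertex_cost c2 c3 c4 c0 c1
   + vertex_cost c3 c4 c0 c1 c2 + vertex_cost c4 c0 c1 c2 c3)%ZZ.

(** Meant for tuples with a corner outside the triangles: that corner supplies half of the unit, and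
    the neighbours only have to give the other half and the costs. *)
Definition rich c0 c1 c2 c3 c4 : bool :=
  (half_unit + max_cost c0 c1 c2 c3 c4 <=? low_demand c0 + low_demand c1 + low_demand c2
   + low_demand c3 + low_demand c4)%ZZ.

Definition enough c0 c1 c2 c3 c4 b0 b1 b2 b3 b4 : bool :=
  (unit_charge <=? balance c0 c1 c2 c3 c4 b0 b1 b2 b3 b4)%ZZ.

Definition base_demand (c : nat) : Z := if special c then 0%ZZ else corner_charge c.

Definition very_rich c0 c1 c2 c3 c4 : bool :=
  (unit_charge + max_cost c0 c1 c2 c3 c4 <=? base_demand c0 + base_demand c1 + base_demand c2
   + base_demand c3 + base_demand c4)%ZZ.

(** The shortcuts [very_rich] and [rich] avoid running through the 32 flag patterns. The [if]s
    replace [&&] because the virtual machine evaluates both arguments of [andb] before the call. *)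
Definition check_tuple c0 c1 c2 c3 c4 : bool :=
  if very_rich c0 c1 c2 c3 c4 then true else
  if (if enough c0 c1 c2 c3 c4 true true true true true then
        if rich c0 c1 c2 c3 c4 then true else
        all_masks (fun b0 b1 b2 b3 b4 =>
          if [&& b0, b1, b2, b3 & b4] then true else enough c0 c1 c2 c3 c4 b0 b1 b2 b3 b4)
      else false)
  then true else covered c0 c1 c2 c3 c4.

Definition all_tuples (P : nat -> nat -> nat -> nat -> nat -> bool) (n : nat) : bool :=
  all (fun c0 => let l := iota 0 c0.+1 in
    all (fun c1 => all (fun c2 => all (fun c3 => all (P c0 c1 c2 c3) l) l) l) l) (iota 0 n).

Lemma check_tuple_all : all_tuples check_tuple 14.
Proof. vm_cast_no_check (erefl true). Qed.

Lemma corner_charge_half c : corner_charge c = (2 * half_corner_charge c)%ZZ.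
Proof. by do 14?[case: c => [//|c]]; rewrite /corner_charge /half_corner_charge /nthZ !nth_default. Qed.

Lemma half_corner_charge_ge0 c : (0 <= half_corner_charge c)%ZZ.
Proof. by do 14?[case: c => [//|c]]; rewrite /half_corner_charge /nthZ nth_default. Qed.
Arguments half_corner_charge_ge0 : clear implicits.

Lemma near_cost_le c0 c1 c2 c3 c4 b0 b1 b2 b3 b4 :
  (near_cost c0 c1 c2 c3 c4 b0 b1 b2 b3 b4 <= near_cost c0 c1 c2 c3 c4 true true false true true)%ZZ.
Proof.
rewrite /near_cost orbT andbT; case: (c1 == 0) => //=; case: (c2 == 0) => //=.
by case: (_ || _) => //; case: ifP => // _; case: ifP.
Qed.
Arguments near_cost_le : clear implicits.

Lemma special_cases (P : nat -> Prop) : P 2 -> P 6 -> P 8 -> forall c, special c -> P c.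
Proof. by move=> ? ? ? c /or3P[] /eqP ->. Qed.

Lemma demand_low c0 c1 c2 c3 c4 b0 b1 b2 b3 b4 : ~~ [&& b0, b1, b2, b3 & b4] ->
  (low_demand c0 <= demand c0 c1 c2 c3 c4 b0 b1 b2 b3 b4)%ZZ.
Proof.
move=> /negPf nt; rewrite /demand /low_demand nt; case: ifP => [|_].
  move: c0; apply: special_cases.
  - by case: (_ || _); case: (_ || _) => //=; case: ifP => // _; case: ifP.
  - by case: (_ || _); case: (_ || _) => //=; case: ifP => // _; case: ifP.
  - by case: (_ || _); case: (_ || _) => //=; case: ifP => // _; case: ifP.
rewrite /corner_share corner_charge_half; have := half_corner_charge_ge0 c0.
by case: ifP => _; case: ifP => _; lia.
Qed.
Arguments demand_low : clear implicits.

Lemma claim_ge0 c0 c1 c2 c3 c4 b0 b1 b2 b3 b4 : (0 <= claim c0 c1 c2 c3 c4 b0 b1 b2 b3 b4)%ZZ.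
Proof. by rewrite /claim /claim_amount; do 4?[case: ifP => //= _]. Qed.
Arguments claim_ge0 : clear implicits.

Lemma near_cost_ge0 c0 c1 c2 c3 c4 b0 b1 b2 b3 b4 :
  (0 <= near_cost c0 c1 c2 c3 c4 b0 b1 b2 b3 b4)%ZZ.
Proof. by rewrite /near_cost; do 4?[case: ifP => //= _]. Qed.
Arguments near_cost_ge0 : clear implicits.

Lemma far_cost_ge0 c0 c1 c2 c3 c4 b0 b1 b2 b3 b4 :
  (0 <= far_cost c0 c1 c2 c3 c4 b0 b1 b2 b3 b4)%ZZ.
Proof. by rewrite /far_cost; do 4?[case: ifP => //= _]. Qed.
Arguments far_cost_ge0 : clear implicits.

Lemma all_iota0 (p : pred nat) n : all p (iota 0 n) -> forall c, c < n -> p c.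
Proof. by move=> /allP h c hc; apply: h; rewrite mem_iota. Qed.

Lemma all_masksP (p : bool -> bool -> bool -> bool -> bool -> bool) :
  all_masks p -> forall b0 b1 b2 b3 b4, p b0 b1 b2 b3 b4.
Proof.
have inb b : b \in [:: true; false] by case: b.
move=> h b0 b1 b2 b3 b4; move: h.
by move=> /allP/(_ b0 (inb _))/allP/(_ b1 (inb _))/allP/(_ b2 (inb _))/allP/(_ b3 (inb _))/allP/(_ b4 (inb _)).
Qed.

Lemma enoughP c0 c1 c2 c3 c4 b0 b1 b2 b3 b4 : enough c0 c1 c2 c3 c4 b0 b1 b2 b3 b4 ->
  (unit_charge <= balance c0 c1 c2 c3 c4 b0 b1 b2 b3 b4)%ZZ.
Proof. by rewrite /enough => h; apply: Zle_bool_imp_le. Qed.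

Lemma all_tuplesP (P : nat -> nat -> nat -> nat -> nat -> bool) n : all_tuples P n ->
  forall c0 c1 c2 c3 c4, c0 < n -> c1 <= c0 -> c2 <= c0 -> c3 <= c0 -> c4 <= c0 -> P c0 c1 c2 c3 c4.
Proof.
move=> h c0 c1 c2 c3 c4 h0 h1 h2 h3 h4.
by move: (all_iota0 h h0) => /all_iota0/(_ _ h1)/all_iota0/(_ _ h2)/all_iota0/(_ _ h3)/all_iota0/(_ _ h4).
Qed.

Lemma demand_ge_base c0 c1 c2 c3 c4 b0 b1 b2 b3 b4 :
  (base_demand c0 <= demand c0 c1 c2 c3 c4 b0 b1 b2 b3 b4)%ZZ.
Proof.
have [t|nt] := boolP [&& b0, b1, b2, b3 & b4]; last first.
  apply: Z.le_trans (demand_low c0 c1 c2 c3 c4 _ _ _ _ _ nt); rewrite /base_demand /low_demand.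
  case: ifP => [|_]; last exact: Z.le_refl.
  by move: c0; apply: special_cases.
rewrite /demand /base_demand t; case: ifP => [|_].
  have one c t' s x : special c -> (0 <= one_demand c t' s x)%ZZ.
    by move: c; apply: special_cases; rewrite /one_demand /=; do 2?[case: ifP => //= _].
  have both c x y : special c -> (0 <= both_demand c x y)%ZZ.
    rewrite /both_demand => sc; case: ifP => _; first exact: Z.le_max_l.
    by do 2?[case: ifP => // _]; move: c sc; apply: special_cases.
  move=> sc; case: ifP => _; case: ifP => _; [exact: both | exact: one | exact: one | ].
  by move: c0 sc; apply: special_cases.
rewrite /corner_share corner_charge_half; have := half_corner_charge_ge0 c0.
by case: ifP => _; case: ifP => _; lia.
Qed.
Arguments demand_ge_base : clear implicits.

Lemma net_gain_low c0 c1 c2 c3 c4 b0 b1 b2 b3 b4 : ~~ [&& b0, b1, b2, b3 & b4] ->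
  (low_demand c0 + (if b0 then 0 else half_unit) - vertex_cost c0 c1 c2 c3 c4
   <= net_gain c0 c1 c2 c3 c4 b0 b1 b2 b3 b4)%ZZ.
Proof.
move=> nt; rewrite /vertex_cost /side_cost /net_gain /mirror.
have := demand_low c0 c1 c2 c3 c4 _ _ _ _ _ nt.
have := near_cost_le c0 c1 c2 c3 c4 b0 b1 b2 b3 b4.
have := near_cost_le c0 c4 c3 c2 c1 b4 b3 b2 b1 b0.
have := claim_ge0 c0 c1 c2 c3 c4 b0 b1 b2 b3 b4; have := claim_ge0 c0 c4 c3 c2 c1 b4 b3 b2 b1 b0.
have far_costE c c1' c2' c3' c4' d0 d1 d2 d3 d4 : far_cost c c1' c2' c3' c4' d0 d1 d2 d3 d4
  = far_cost c c1' c2' c3' c4' true true true true true by [].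
rewrite ![far_cost _ _ _ _ _ b0 _ _ _ _]far_costE ![far_cost _ _ _ _ _ b4 _ _ _ _]far_costE.
by lia.
Qed.
Arguments net_gain_low c0 c1 c2 c3 c4 [b0 b1 b2 b3 b4].

Lemma net_gain_ge_base c0 c1 c2 c3 c4 b0 b1 b2 b3 b4 :
  (base_demand c0 - vertex_cost c0 c1 c2 c3 c4 <= net_gain c0 c1 c2 c3 c4 b0 b1 b2 b3 b4)%ZZ.
Proof.
rewrite /vertex_cost /side_cost /net_gain /mirror.
have := demand_ge_base c0 c1 c2 c3 c4 b0 b1 b2 b3 b4.
have := near_cost_le c0 c1 c2 c3 c4 b0 b1 b2 b3 b4.
have := near_cost_le c0 c4 c3 c2 c1 b4 b3 b2 b1 b0.
have := claim_ge0 c0 c1 c2 c3 c4 b0 b1 b2 b3 b4; have := claim_ge0 c0 c4 c3 c2 c1 b4 b3 b2 b1 b0.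
have g0 : (0 <= if b0 then 0 else half_unit)%ZZ by case: b0.
have far_costE c c1' c2' c3' c4' d0 d1 d2 d3 d4 : far_cost c c1' c2' c3' c4' d0 d1 d2 d3 d4
  = far_cost c c1' c2' c3' c4' true true true true true by [].
rewrite ![far_cost _ _ _ _ _ b0 _ _ _ _]far_costE ![far_cost _ _ _ _ _ b4 _ _ _ _]far_costE.
by lia.
Qed.
Arguments net_gain_ge_base : clear implicits.

Lemma balance_enough c0 c1 c2 c3 c4 b0 b1 b2 b3 b4 :
  c0 < 14 -> c1 <= c0 -> c2 <= c0 -> c3 <= c0 -> c4 <= c0 ->
  ~~ covered c0 c1 c2 c3 c4 ->
  (unit_charge <= balance c0 c1 c2 c3 c4 b0 b1 b2 b3 b4)%ZZ.
Proof.
move=> h0 h1 h2 h3 h4 nc.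
have := all_tuplesP check_tuple_all h0 h1 h2 h3 h4.
rewrite /check_tuple (negPf nc); case: ifP => [r _|_].
  move: (Zle_bool_imp_le _ _ r); rewrite /max_cost /balance.
  have := net_gain_ge_base c0 c1 c2 c3 c4 b0 b1 b2 b3 b4.
  have := net_gain_ge_base c1 c2 c3 c4 c0 b1 b2 b3 b4 b0.
  have := net_gain_ge_base c2 c3 c4 c0 c1 b2 b3 b4 b0 b1.
  have := net_gain_ge_base c3 c4 c0 c1 c2 b3 b4 b0 b1 b2.
  have := net_gain_ge_base c4 c0 c1 c2 c3 b4 b0 b1 b2 b3.
  by lia.
case: ifP => // + _; case: ifP => // eT.
have [|nt] := boolP [&& b0, b1, b2, b3 & b4].
  by move=> /and5P[-> -> -> -> ->] _; exact: enoughP eT.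
case: ifP => [r _|_ /all_masksP/(_ b0 b1 b2 b3 b4)]; last first.
  by rewrite (negPf nt); exact: enoughP.
have {}r := Zle_bool_imp_le _ _ r.
have rot x0 x1 x2 x3 x4 : [&& x0, x1, x2, x3 & x4] = [&& x1, x2, x3, x4 & x0].
  by case: x0; case: x1; case: x2; case: x3; case: x4.
have hh : (half_unit <= (if b0 then 0 else half_unit) + (if b1 then 0 else half_unit) +
  (if b2 then 0 else half_unit) + (if b3 then 0 else half_unit) + (if b4 then 0 else half_unit))%ZZ.
  by move: nt; case: b0; case: b1; case: b2; case: b3; case: b4.
have n1 := nt; rewrite rot in n1; have n2 := n1; rewrite rot in n2.
have n3 := n2; rewrite rot in n3; have n4 := n3; rewrite rot in n4.
move: r; rewrite /rich /max_cost /balance.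
have := net_gain_low c0 c1 c2 c3 c4 nt; have := net_gain_low c1 c2 c3 c4 c0 n1.
have := net_gain_low c2 c3 c4 c0 c1 n2; have := net_gain_low c3 c4 c0 c1 c2 n3.
have := net_gain_low c4 c0 c1 c2 c3 n4.
move: hh; have -> : unit_charge = (half_unit + half_unit)%ZZ by [].
by lia.
Qed.

(** * Closed walks around a vertex of degree 7, 11 or 13 *)

(* States of a corner between consecutive neighbours x, y of a vertex w of degree 7, 11 or 13:
   c < 14 if x and y are 5-vertices, w x y is a triangle and so is the face beyond the edge x y,
   whose third vertex has class c; 15 if only w x y is a triangle; 14 if x and y are 5-vertices
   but the corner is not in a triangle; 16, 17, 18 if only x, only y, none of them is a
   5-vertex.  When the corner is not in a triangle, a neighbour of w sees two possible states. *)
Definition right_states (b : bool) (c : nat) (b' : bool) (c' : nat) : seq nat :=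
  if b then (if c == 0 then (if b' then [:: c'] else [:: 15]) else [:: 16]) else [:: 14; 16].
Definition left_states (b : bool) (c : nat) (b' : bool) (c' : nat) : seq nat :=
  if b then (if c == 0 then (if b' then [:: c'] else [:: 15]) else [:: 17]) else [:: 14; 17].

(* The weight of the impossible transitions. *)
Definition minus_infinity : Z := (-10000000000)%ZZ.

(** Two states below 14 do not tell whether the corner of the receiver opposite to the sender lies
    in a triangle. Hence the maximum with [opposite_charge], which is all that remains when
    [covered] excludes the triangular case. *)
Definition link_demand (d a b : nat) : Z :=
  if (if a < 16 then true else a == 17) then
    if b < 17 then
      if (if a < 14 then b < 14 else false) then
        if covered d 0 a b 0 then opposite_charge d else Z.max (opposite_charge d) (both_demand d a b)
      else if (if a == 17 then b == 16 else false) then iso_charge d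
      else if (if a == 17 then true else b == 16) then
        let t := if a == 17 then b else a in
        if (if d == 6 then t == 5 else false) then 144144%ZZ
        else if (if d == 8 then t == 3 else false) then 180180%ZZ else one_charge d
      else if (if a == 14 then true else b == 14) then both_charge d else side_charge d
    else minus_infinity
  else if b < 17 then minus_infinity else 0%ZZ.

(* A corner of w outside the triangles brings charge 1/2 to w. *)
Definition link_weight (d a b : nat) : Z :=
  if b == 14 then (link_demand d a b - half_unit)%ZZ else link_demand d a b.

Definition link_demand_ok (mask : bool) (d c1 c2 c3 c4 : nat) (b0 b1 b2 b3 b4 : bool) : bool :=
  if (if [&& b0, b1, b2, b3 & b4] then ~~ mask else mask) then true else
  if all (fun a => all (fun b =>
      (demand d c1 c2 c3 c4 b0 b1 b2 b3 b4 <=? link_demand d a b)%ZZ)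
      (right_states b4 c4 b3 c3)) (left_states b0 c1 b1 c2) then true
  else if mask then covered d c1 c2 c3 c4 else false.

Definition all_views (P : nat -> nat -> nat -> nat -> bool -> bool -> bool -> bool -> bool -> bool)
    (l1 l4 : seq nat) (m : seq bool) : bool :=
  all (fun c1 => all (fun c4 => all (fun c2 => all (fun c3 =>
   all (fun b0 => all (fun b1 => all (fun b2 => all (fun b3 => all (fun b4 =>
    P c1 c2 c3 c4 b0 b1 b2 b3 b4) m) m) m) m) m) (iota 0 14)) (iota 0 14)) l4) l1.

Lemma all_viewsP P l1 l4 m : all_views P l1 l4 m -> forall c1 c2 c3 c4 b0 b1 b2 b3 b4,
  c1 \in l1 -> c2 < 14 -> c3 < 14 -> c4 \in l4 ->
  b0 \in m -> b1 \in m -> b2 \in m -> b3 \in m -> b4 \in m -> P c1 c2 c3 c4 b0 b1 b2 b3 b4.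
Proof.
move=> h c1 c2 c3 c4 b0 b1 b2 b3 b4 h1 h2 h3 h4 k0 k1 k2 k3 k4; move: h.
move=> /allP/(_ c1 h1)/allP/(_ c4 h4)/all_iota0/(_ c2 h2)/all_iota0/(_ c3 h3).
by move=> /allP/(_ b0 k0)/allP/(_ b1 k1)/allP/(_ b2 k2)/allP/(_ b3 k3)/allP/(_ b4 k4).
Qed.

Lemma link_demand_triangular_left :
  all (fun d => all_views (link_demand_ok true d) [:: 0] (iota 0 14) [:: true]) [:: 2; 6; 8].
Proof. vm_cast_no_check (erefl true). Qed.

Lemma link_demand_triangular_right :
  all (fun d => all_views (link_demand_ok true d) (iota 0 14) [:: 0] [:: true]) [:: 2; 6; 8].
Proof. vm_cast_no_check (erefl true). Qed.

Lemma link_demand_other :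
  all (fun d => all_views (link_demand_ok false d) [:: 0; 1] [:: 0; 1] [:: false; true]) [:: 2; 6; 8].
Proof. vm_cast_no_check (erefl true). Qed.

(** With a corner outside the triangles the two outer classes matter only through being 0 or not.
    This is why [link_demand_other] lets them range over 0 and 1. *)
Lemma demand_class1 d c1 c2 c3 c4 b0 b1 b2 b3 b4 : special d -> ~~ [&& b0, b1, b2, b3 & b4] ->
  demand d (c1 != 0) c2 c3 (c4 != 0) b0 b1 b2 b3 b4 = demand d c1 c2 c3 c4 b0 b1 b2 b3 b4.
Proof. by rewrite /demand => -> /negPf ->; rewrite !eqb0 !negbK. Qed.

Lemma demand_le_link d c1 c2 c3 c4 b0 b1 b2 b3 b4 a b : special d ->
  c1 < 14 -> c2 < 14 -> c3 < 14 -> c4 < 14 -> ~~ covered d c1 c2 c3 c4 ->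
  a \in left_states b0 c1 b1 c2 -> b \in right_states b4 c4 b3 c3 ->
  (demand d c1 c2 c3 c4 b0 b1 b2 b3 b4 <= link_demand d a b)%ZZ.
Proof.
move=> sd h1 h2 h3 h4 nc ha hb.
have dl : d \in [:: 2; 6; 8] by rewrite !inE.
have i14 c : c < 14 -> c \in iota 0 14 by rewrite mem_iota.
have [t|nt] := boolP [&& b0, b1, b2, b3 & b4].
  move: (t) => /and5P[t0 t1 t2 t3 t4].
  have [c14|] := boolP ((c1 == 0) || (c4 == 0)); last first.
    rewrite negb_or => /andP[/negPf n1 /negPf n4].
    move: ha hb; rewrite /left_states /right_states t0 t4 n1 n4 !inE => /eqP -> /eqP ->.
    by rewrite /demand sd n1 n4 /= /link_demand; exact: Z.le_refl.
  have : link_demand_ok true d c1 c2 c3 c4 b0 b1 b2 b3 b4.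
    by case/orP: c14 => z; [have /allP/(_ d dl)/all_viewsP := link_demand_triangular_left |
      have /allP/(_ d dl)/all_viewsP := link_demand_triangular_right]; apply;
      rewrite ?i14 ?inE ?t0 ?t1 ?t2 ?t3 ?t4.
  rewrite /link_demand_ok [~~ true]/= (negPf nc) t.
  case: ifP => // /allP H _.
  by move: ha hb => /H/allP h /h; exact: Zle_bool_imp_le.
have /allP/(_ d dl)/all_viewsP := link_demand_other.
move=> /(_ (c1 != 0) c2 c3 (c4 != 0) b0 b1 b2 b3 b4 _ h2 h3).
have i1 (x : bool) : (x : nat) \in [:: 0; 1] by case: x.
have ib (x : bool) : x \in [:: false; true] by case: x.
move=> /(_ (i1 _) (i1 _) (ib _) (ib _) (ib _) (ib _) (ib _)).
rewrite /link_demand_ok (negPf nt) demand_class1//; case: ifP => // /allP H _.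
move: ha hb; rewrite /left_states /right_states -{1}[c1 == 0]negbK -{1}[c4 == 0]negbK.
rewrite -[~~ (c1 != 0)]eqb0 -[~~ (c4 != 0)]eqb0.
by move=> /H/allP h /h; exact: Zle_bool_imp_le.
Qed.

(** Product of a vector with a matrix in the (max, +) algebra: iterating it yields the maximal
    weights of walks of a given length. *)
Definition link_step (W : seq (seq Z)) (v : seq Z) : seq Z :=
  [seq foldr Z.max minus_infinity [seq (p.1 + p.2)%ZZ | p <- zip v w] | w <- W].

Definition link_matrix (d : nat) : seq (seq Z) :=
  [seq [seq link_weight d a b | a <- iota 0 19] | b <- iota 0 19].

Definition link_start (s : nat) : seq Z :=
  [seq if a == s then 0%ZZ else minus_infinity | a <- iota 0 19].

Definition check_link (d n : nat) (m : Z) : bool :=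
  let W := link_matrix d in
  all (fun s => (nthZ (iter n (link_step W) (link_start s)) s <=? m)%ZZ) (iota 0 19).

(** The bounds are d - 6 units, and they hold because the lengths are odd: the largest demands on
    5-neighbours inside triangles cannot occur at every step. One step less exhausts the bound: 6 *
    40040, 10 * 120120 and 12 * 134134 + 72072. Likewise at most three 5-neighbours of a vertex of
    degree 7 are isolated, and 3 * 80080 is its whole charge. *)
Lemma check_link_true :
  [&& check_link 2 7 240240, check_link 6 11 1201200 & check_link 8 13 1681680].
Proof. vm_cast_no_check (erefl true). Qed.

Lemma foldr_max (s : seq Z) m x : x \in s -> (x <= foldr Z.max m s)%ZZ.
Proof.
elim: s => // y s IH; rewrite inE => /orP[/eqP -> | /IH h] /=; first exact: Z.le_max_l.
exact: Z.le_trans h (Z.le_max_r _ _).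
Qed.

Lemma link_step_ge W v n a b : size W = n -> size v = n -> a < n -> b < n ->
  size (nth [::] W b) = n ->
  (nthZ v a + nthZ (nth [::] W b) a <= nthZ (link_step W v) b)%ZZ.
Proof.
move=> sW sv an bn sw; rewrite /nthZ /link_step (nth_map [::]) ?sW//.
apply: foldr_max; apply/mapP; exists (nth 0%ZZ v a, nth 0%ZZ (nth [::] W b) a) => //.
by rewrite -nth_zip ?sv ?sw// mem_nth// size_zip sv sw minnn.
Qed.

Lemma link_walk d (st : nat -> nat) n : (forall i, st i < 19) ->
  (\sum_(i < n) link_weight d (st i) (st i.+1) <=
   nthZ (iter n (link_step (link_matrix d)) (link_start (st 0))) (st n))%R.
Proof.
move=> hst; elim: n => [|n IH].
  by rewrite big_ord0 /nthZ [iter _ _ _]/(link_start _) (nth_map 0) ?size_iota// nth_iota// add0n eqxx.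
rewrite big_ord_recr iterS [X in (X <= _)%R]/=.
have sW : size (link_matrix d) = 19 by rewrite size_map size_iota.
have sv k : size (iter k (link_step (link_matrix d)) (link_start (st 0))) = 19.
  by case: k => [|k]; [rewrite size_map size_iota | rewrite iterS size_map].
have sr b : b < 19 -> nth [::] (link_matrix d) b = [seq link_weight d a b | a <- iota 0 19].
  by move=> hb; rewrite (nth_map 0) ?size_iota// nth_iota.
have := @link_step_ge (link_matrix d) _ 19 (st n) (st n.+1) sW (sv n) (hst n) (hst n.+1).
rewrite sr// size_map size_iota => /(_ erefl).
have -> : nthZ [seq link_weight d a (st n.+1) | a <- iota 0 19] (st n) = link_weight d (st n) (st n.+1).
  by rewrite /nthZ (nth_map 0) ?size_iota// nth_iota.
move=> h; apply: Order.POrderTheory.le_trans (Num.Theory.lerD IH (Order.POrderTheory.lexx _)) _.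
exact/Z.leb_le.
Qed.

Lemma link_closed_walk d n m (st : nat -> nat) : check_link d n m -> (forall i, st i < 19) ->
  st n = st 0 -> (\sum_(i < n) link_weight d (st i) (st i.+1) <= m)%R.
Proof.
move=> h hst e; have := link_walk d n hst.
move: h; rewrite /check_link => /all_iota0/(_ _ (hst 0))/Zle_bool_imp_le h; rewrite e => h'.
by apply/Z.leb_le; apply: Z.le_trans h; apply/Z.leb_le.
Qed.

Lemma ZleP (x y : Z) : (x <= y)%ZZ <-> (x <= y)%R.
Proof. by symmetry; apply: Z.leb_le. Qed.

(** This comes from the entries 5,5,9,5,17 and 5,5,10,5,12 of the list. It puts a 5-vertex [u'] that
    pays a far claim between two vertices of degree at least 13, [L] and [p], so that it can afford
    the payment. *)
Lemma covered_far k p : (k == 3) || (k == 5) -> ~~ covered k 0 0 p 0 -> 8 <= p.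
Proof. by case/orP => /eqP ->; do 8?[case: p => [//|p]]. Qed.

Lemma covered_mirror c0 c1 c2 c3 c4 : covered c0 c4 c3 c2 c1 = covered c0 c1 c2 c3 c4.
Proof. by apply: eq_has => s; rewrite orbC. Qed.

(** * Claims between neighbouring 5-vertices *)

Definition view (T D : finType) (head : D -> T) (next : D -> D) (tri : D -> bool) (cl : T -> nat)
    (A : Type) (f : nat -> nat -> nat -> nat -> nat -> bool -> bool -> bool -> bool -> bool -> A) (d : D) : A :=
  let c d := cl (head d) in
  let d1 := next d in let d2 := next d1 in let d3 := next d2 in let d4 := next d3 in
  f (c d) (c d1) (c d2) (c d3) (c d4) (tri d) (tri d1) (tri d2) (tri d3) (tri d4).

Section Claims.
Variables (T D : finType) (tail head : D -> T) (rev next prev : D -> D) (tri : D -> bool).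
Variable cl : T -> nat.
Hypothesis revK : involutive rev.
Hypothesis tail_rev : forall d, tail (rev d) = head d.
Hypothesis nextK : cancel next prev.
Hypothesis prevK : cancel prev next.
Hypothesis tail_next : forall d, tail (next d) = tail d.
Hypothesis tri_next : forall d, tri d -> rev (next d) = prev (rev (prev (rev d))).
Hypothesis five_prev : forall d, cl (tail d) = 0 -> next (next (next (next d))) = prev d.
Hypothesis uncovered : forall d, cl (tail d) = 0 ->
  ~~ view head next tri cl (fun c0 c1 c2 c3 c4 _ _ _ _ _ => covered c0 c1 c2 c3 c4) d.
Local Notation look := (view head next tri cl).

Lemma triangle_head_rev d : head (rev d) = tail d.
Proof. by rewrite -tail_rev revK. Qed.

Lemma triangle_tail_prev d : tail (prev d) = tail d.
Proof. by rewrite -{2}(prevK d) tail_next. Qed.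

Lemma triangle_head d : tri d -> head (prev (rev d)) = head (next d).
Proof.
move=> /tri_next /(congr1 tail); rewrite tail_rev => ->.
by rewrite triangle_tail_prev tail_rev.
Qed.

Lemma triangle_next d : tri d -> next (rev (next d)) = rev (prev (rev d)).
Proof. by move=> /tri_next ->; rewrite prevK. Qed.

(* Darts at the two possible donors, from which near_cost and the mirror of far_cost
   account for the claim at d. *)
Let near_dart d := prev (rev (next (next d))).
Let far_dart d := next (rev (next d)).
Let near_charge g := if cl (tail g) == 0 then look near_cost g else 0%ZZ.
Let far_charge g := if cl (tail g) == 0 then look (mirror far_cost) g else 0%ZZ.

Let near_charge_ge0 g : (0 <= near_charge g)%ZZ.
Proof. by rewrite /near_charge; case: ifP => // _; apply: near_cost_ge0. Qed.
Let far_charge_ge0 g : (0 <= far_charge g)%ZZ.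
Proof. by rewrite /far_charge; case: ifP => // _; apply: far_cost_ge0. Qed.

(** The vertex [t] pays unless its last neighbour is a 5-vertex and its corner between [u'] and [p]
    lies in a triangle. In that case [five_prev] determines the rotation at [u'] well enough to show
    [L] and [p] among its neighbours in the places that [far_cost] inspects. *)
Lemma claim_le_charges d : cl (tail d) = 0 ->
  (look claim d <= near_charge (near_dart d) + far_charge (far_dart d))%ZZ.
Proof.
move=> zd; have n0 := @near_charge_ge0 (near_dart d); have f0 := @far_charge_ge0 (far_dart d).
rewrite {1}/view /claim; case: ifP => [|_]; last by lia.
move=> /and5P[t0 t1 t2 _ /and4P[_ /eqP z1 /eqP z2 _]].
pose e := rev (prev (rev (next d))).
have ne : next (rev (next (next d))) = e by rewrite (triangle_next t1).
have he : head e = head (next d) by rewrite triangle_head_rev triangle_tail_prev tail_rev.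
have tn : cl (tail (near_dart d)) = 0 by rewrite triangle_tail_prev tail_rev z2.
have vn : near_charge (near_dart d) = near_cost (cl (head (next (next (next d))))) 0 0
  (cl (head (next e))) (cl (head (next (next e)))) true true (tri e) true true.
  rewrite /near_charge tn eqxx /view /near_dart prevK ne he z1 triangle_head_rev !tail_next zd.
  by rewrite (triangle_head t2).
have un := uncovered tn; move: un.
rewrite /view /near_dart prevK ne he z1 triangle_head_rev !tail_next zd (triangle_head t2) => un.
have tf : cl (tail (far_dart d)) = 0 by rewrite tail_next tail_rev z1.
move: n0 f0; rewrite {}vn /near_cost /=; set k := cl (head (next (next (next d)))) in un *.
case: (boolP ((0 < _) || _)) => [_|].
  rewrite /claim_amount; case: (k == 3); case: (k == 5); rewrite ?andbF ?andbT;
  by do 3?[case: ifP => _]; lia.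
rewrite negb_or negbK lt0n negbK => /andP[/eqP z4 te]; rewrite z4 in un.
have E4 : next (next (next (next (far_dart d)))) = rev (next d) by rewrite five_prev// nextK.
have E3 : next (next (next (far_dart d))) = prev (rev (next d)) by rewrite -E4 nextK.
have E2 : next (next (far_dart d)) = prev (rev e) by rewrite revK -E3 nextK.
have -> : far_charge (far_dart d) = far_cost (cl (head d)) 0 0 (cl (head (next e)))
    (cl (head (next (far_dart d)))) true true true true true.
  rewrite /far_charge tf eqxx /view /mirror E4 E3 E2 triangle_head_rev tail_next zd.
  rewrite (triangle_head t1) z2 (triangle_head te) /far_dart (triangle_next t0).
  by rewrite triangle_head_rev triangle_tail_prev tail_rev.
move=> _; rewrite /claim_amount /far_cost /=.
case: (boolP ((k == 3) || (k == 5))) => [k35|]; last first.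
  rewrite negb_or => /andP[/negPf -> /negPf ->]; rewrite !andbF /=.
  by lia.
rewrite (covered_far k35 un); case: (cl (head d) == 12); case: (cl (head d) == 8);
  case: (cl (head d) == 9); case: (k == 3); case: (k == 5) => //= _; lia.
Qed.

(** Both [near_dart] and [far_dart] are injective, so no cost serves two claims. *)
Lemma claim_sum : (\sum_(d | cl (tail d) == 0%N) look claim d <=
  \sum_(d | cl (tail d) == 0%N) look near_cost d
  + \sum_(d | cl (tail d) == 0%N) look (mirror far_cost) d)%R.
Proof.
have revi := inv_inj revK.
have ni : injective near_dart by move=> x y /(can_inj prevK)/revi/(can_inj nextK)/(can_inj nextK).
have fi : injective far_dart by move=> x y /(can_inj nextK)/revi/(can_inj nextK).
have -> : (\sum_(d | cl (tail d) == 0%N) look near_cost d = \sum_d near_charge (near_dart d))%R.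
  by rewrite big_mkcond (reindex_inj ni).
have -> : (\sum_(d | cl (tail d) == 0%N) look (mirror far_cost) d = \sum_d far_charge (far_dart d))%R.
  by rewrite big_mkcond (reindex_inj fi).
rewrite -big_split big_mkcond; apply: ler_sum => d _; apply/ZleP.
have [h|_] := eqVneq (cl (tail d)) 0%N; first exact: (claim_le_charges h).
exact: Z.add_nonneg_nonneg (@near_charge_ge0 (near_dart d)) (@far_charge_ge0 (far_dart d)).
Qed.

End Claims.

(** * Discharging *)

Definition degree_class (n : nat) : nat :=
  count (fun k => k < n) [:: 5; 6; 7; 8; 9; 10; 11; 12; 13; 14; 15; 17; 35].

Lemma degree_class_lt n : degree_class n < 14.
Proof. exact: leq_ltn_trans (count_size _ _) _. Qed.

Lemma degree_class0 n : (degree_class n == 0) = (n <= 5).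
Proof. by rewrite /degree_class /=; apply/idP/idP; lia. Qed.

Lemma degree_class_special n : special (degree_class n) ->
  [\/ degree_class n = 2 /\ n = 7, degree_class n = 6 /\ n = 11 | degree_class n = 8 /\ n = 13].
Proof.
case/or3P => /eqP e; [apply: Or31 | apply: Or32 | apply: Or33]; split=> //;
  by move: e; rewrite /degree_class /=; lia.
Qed.

Lemma degree_corner_charge n : 5 < n ->
  (Z.of_nat n * corner_charge (degree_class n) <= (Z.of_nat n - 6) * unit_charge)%ZZ.
Proof.
move=> n5; have [h|h] := ltnP 35 n.
  have -> : degree_class n = 13 by rewrite /degree_class /=; lia.
  have -> : corner_charge 13 = 200200%ZZ by [].
  by rewrite /unit_charge; lia.
have : n \in iota 6 30 by rewrite mem_iota; lia.
have : all (fun n => Z.of_nat n * corner_charge (degree_class n) <=? (Z.of_nat n - 6) * unit_charge)%ZZ (iota 6 30).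
  by vm_compute.
by move=> /allP H /H /Zle_bool_imp_le.
Qed.

Lemma corner_sum c (b x5 y5 : bool) (x y : nat) : c < 14 -> x5 = (x == 0) -> y5 = (y == 0) ->
  ((if x5 then corner_share c b y else 0) + (if y5 then corner_share c b x else 0)
   <= corner_charge c + (if b then 0 else half_unit))%ZZ.
Proof.
move=> c14 -> ->; rewrite /corner_share.
have h0 := half_corner_charge_ge0 c; have ch := corner_charge_half c.
have ge0 : (0 <= half_unit)%ZZ by [].
have small : (c <= 7) -> (corner_charge c <= half_unit)%ZZ by clear; case: c => [|[|[|[|[|[|[|[|c]]]]]]]] //= _; vm_compute.
have {}small : (7 < c) = false -> (corner_charge c <= half_unit)%ZZ.
  by move=> h; apply: small; rewrite leqNgt h.
case E: (7 < c); [move: small => _ | move/(_ E): small => small];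
  by case: (x == 0); case: (y == 0); case: b => /=; lia.
Qed.

Local Arguments net_gain : simpl never.

Section Discharging.
Variables (T D : finType) (tail head : D -> T) (rev next prev : D -> D) (tri : D -> bool).
Hypothesis revK : involutive rev.
Hypothesis tail_rev : forall d, tail (rev d) = head d.
Hypothesis nextK : cancel next prev.
Hypothesis prevK : cancel prev next.
Hypothesis tail_next : forall d, tail (next d) = tail d.
Hypothesis next_connect : forall d e, tail d = tail e -> fconnect next d e.
Hypothesis tri_next : forall d, tri d -> rev (next d) = prev (rev (prev (rev d))).
Hypothesis tri_prev : forall d, tri (prev (rev d)) = tri d.

Let dg x := #|[pred d | tail d == x]|.
Hypothesis min_deg : forall x, 5 <= dg x.
Let cl x := degree_class (dg x).
Local Notation look := (view head next tri cl).

Hypothesis uncovered : forall d, cl (tail d) = 0 ->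
  ~~ look (fun c0 c1 c2 c3 c4 _ _ _ _ _ => covered c0 c1 c2 c3 c4) d.

Let next_inj : injective next := can_inj nextK.
Let rev_inj : injective rev := inv_inj revK.
Let head_rev d : head (rev d) = tail d. Proof. by rewrite -tail_rev revK. Qed.
Let tail_prev d : tail (prev d) = tail d. Proof. by rewrite -{2}(prevK d) tail_next. Qed.
Let cl14 x : cl x < 14. Proof. exact: degree_class_lt. Qed.
Let tri_rev d : tri (rev d) = tri (prev d). Proof. by rewrite -[in LHS]tri_prev revK. Qed.
Let thead := triangle_head tail_rev prevK tail_next tri_next.
Let tnext := triangle_next prevK tri_next.

Lemma order_degree d : order next d = dg (tail d).
Proof.
apply: eq_card => e; rewrite !inE; apply/idP/eqP => [|te]; last exact: next_connect.
by move=> /iter_findex <-; elim: (findex _ _ _) => // n IH; rewrite iterS tail_next.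
Qed.

Lemma iter_degree d : iter (dg (tail d)) next d = d.
Proof. by rewrite -order_degree iter_order. Qed.

Lemma sum_link (F : D -> Z) d :
  (\sum_(e | tail e == tail d) F e = \sum_(i < dg (tail d)) F (iter i next d))%R.
Proof.
rewrite (eq_bigl (mem (orbit next d))) => [|e]; last first.
  rewrite [RHS]/= -fconnect_orbit; apply/eqP/idP => [|te]; first by move=> te; exact: next_connect.
  by move: te => /iter_findex <-; elim: (findex _ _ _) => // n IH; rewrite iterS tail_next.
rewrite -big_uniq ?orbit_uniq// (big_nth d) size_orbit order_degree big_mkord.
by apply: eq_bigr => i _; rewrite /orbit nth_traject// order_degree.
Qed.

Lemma five_cycle d : cl (tail d) = 0 -> next (next (next (next (next d)))) = d.
Proof.
move=> /eqP; rewrite degree_class0 => le; have := iter_degree d.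
by have -> : dg (tail d) = 5 by have := min_deg (tail d); lia.
Qed.

Lemma five_prev d : cl (tail d) = 0 -> next (next (next (next d))) = prev d.
Proof. by move=> /five_cycle {2}<-; rewrite nextK. Qed.

Lemma claims_paid : (\sum_(d | cl (tail d) == 0%N) (look claim d + look (mirror claim) d)%ZZ <=
  \sum_(d | cl (tail d) == 0%N) (look near_cost d + look (mirror near_cost) d
     + look far_cost d + look (mirror far_cost) d)%ZZ)%R.
Proof.
have A := claim_sum revK tail_rev nextK prevK tail_next tri_next five_prev uncovered.
have M A' (f : nat -> nat -> nat -> nat -> nat -> bool -> bool -> bool -> bool -> bool -> A') d :
    cl (tail d) = 0 -> view head prev (fun d => tri (prev d)) cl f d = look (mirror f) d.
  move=> z; rewrite /view /mirror.
  have e4 := five_prev z; have e5 := five_cycle z.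
  have p4 : prev (prev d) = next (next (next d)) by rewrite -e4 nextK.
  have p3 : prev (prev (prev d)) = next (next d) by rewrite p4 nextK.
  have p2 : prev (prev (prev (prev d))) = next d by rewrite p3 nextK.
  have p1 : prev (prev (prev (prev (prev d)))) = d by rewrite p2 nextK.
  by rewrite p1 p2 p3 p4 e4.
(* The mirrored inequality is the same lemma for the reflected rotation system: [next] and [prev]
   are exchanged, and the corner after [d] becomes the one before it. *)
have := @claim_sum T D tail head rev prev next (fun d => tri (prev d)) cl revK tail_rev prevK nextK tail_prev.
have tn d : tri (prev d) -> rev (prev d) = next (rev (next (rev d))).
  move=> /tri_next e; rewrite prevK in e; rewrite [in RHS]e prevK.
  by rewrite revK prevK.
move=> /(_ tn).
have f5 d : cl (tail d) = 0 -> prev (prev (prev (prev d))) = next d.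
  by move=> /five_cycle {1}<-; rewrite !nextK.
move=> /(_ f5).
have un d : cl (tail d) = 0 ->
    ~~ view head prev (fun d => tri (prev d)) cl (fun c0 c1 c2 c3 c4 _ _ _ _ _ => covered c0 c1 c2 c3 c4) d.
  by move=> z; rewrite M// /view /mirror covered_mirror; exact: uncovered.
move=> /(_ un) B.
have E A' (f : nat -> nat -> nat -> nat -> nat -> bool -> bool -> bool -> bool -> bool -> A') (g : A' -> Z) :
   (\sum_(d | cl (tail d) == 0%N) g (view head prev (fun d => tri (prev d)) cl f d)
   = \sum_(d | cl (tail d) == 0%N) g (look (mirror f) d))%R.
  by apply: eq_bigr => d /eqP z; rewrite M.
rewrite !(E Z _ id) in B; have {A B} := lerD A B.
rewrite -!big_split /=; congr (_ <= _)%R.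
by apply: eq_bigr => d _; rewrite /mirror /view /=; lia.
Qed.

Let dem d := if cl (tail d) == 0 then look demand d else 0%ZZ.
Let gift d : Z := if tri d then 0%ZZ else half_unit.

Let dem_five e : cl (head e) == 0 ->
  dem (rev e) = demand (cl (tail e)) (cl (head (next (rev e)))) (cl (head (next (next (rev e)))))
    (cl (head (prev (prev (rev e))))) (cl (head (prev (rev e))))
    (tri (prev e)) (tri (next (rev e))) (tri (next (next (rev e)))) (tri (prev (prev (rev e)))) (tri e).
Proof.
move=> z; rewrite /dem tail_rev z /view head_rev.
have z' : cl (tail (rev e)) = 0 by rewrite tail_rev; apply/eqP.
have e4 := five_prev z'.
have e3 : next (next (next (rev e))) = prev (prev (rev e)) by rewrite -e4 nextK.
by rewrite e3 prevK tri_prev tri_rev.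
Qed.

Lemma link_generic w : 5 < dg w -> ~~ special (cl w) ->
  (\sum_(e | tail e == w) dem (rev e) <=
   \sum_(e | tail e == w) (corner_charge (cl w) + gift e)%ZZ)%R.
Proof.
move=> w5 ns.
pose r e := if cl (head e) == 0 then corner_share (cl w) (tri e) (cl (head (next e))) else 0%ZZ.
pose l e := if cl (head e) == 0 then corner_share (cl w) (tri (prev e)) (cl (head (prev e))) else 0%ZZ.
apply: (@le_trans _ _ (\sum_(e | tail e == w) (r e + l e)%ZZ)%R).
  apply: ler_sum => e /eqP te; apply/ZleP; rewrite /r /l.
  have [z|nz] := boolP (cl (head e) == 0); last by rewrite /dem tail_rev (negPf nz).
  rewrite (dem_five z) te /demand (negPf ns) Z.add_comm.
  have E1 : corner_share (cl w) (tri e) (cl (head (prev (rev e)))) =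
    corner_share (cl w) (tri e) (cl (head (next e))).
    by rewrite /corner_share; case: (boolP (tri e)) => // /thead ->.
  have E2 : corner_share (cl w) (tri (prev e)) (cl (head (next (rev e)))) =
    corner_share (cl w) (tri (prev e)) (cl (head (prev e))).
    rewrite /corner_share; case: (boolP (tri (prev e))) => // /tnext; rewrite prevK => ->.
    by rewrite head_rev tail_prev tail_rev.
  rewrite E1 E2; exact: Z.le_refl.
(* Regroup by corners: [r e] and [l (next e)] are the two shares of the corner between [e] and
   [next e], which [corner_sum] bounds together. *)
have -> : (\sum_(e | tail e == w) (r e + l e)%ZZ = \sum_(e | tail e == w) (r e + l (next e))%ZZ)%R.
  have sp (F G : D -> Z) : (\sum_(e | tail e == w) (F e + G e)%ZZ =
      \sum_(e | tail e == w) F e + \sum_(e | tail e == w) G e)%R by rewrite -big_split.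
  rewrite !sp; congr (_ + _)%R; rewrite [LHS](reindex_inj next_inj) /=.
  by apply: eq_bigl => e; rewrite tail_next.
apply: ler_sum => e _; apply/ZleP; rewrite /r /l /gift nextK.
exact: corner_sum.
Qed.

Let state e : nat :=
  if cl (head e) == 0 then
    if cl (head (next e)) == 0 then
      if tri e then
        if tri (prev (prev (rev e))) then cl (head (prev (prev (rev e)))) else 15
      else 14
    else 16
  else if cl (head (next e)) == 0 then 17 else 18.

Let state_lt e : state e < 19.
Proof. by rewrite /state; do 4?case: ifP => // _; exact: ltn_trans (cl14 _) _. Qed.

Let state_right e : cl (head e) == 0 ->
  state e \in right_states (tri e) (cl (head (prev (rev e))))
    (tri (prev (prev (rev e)))) (cl (head (prev (prev (rev e))))).
Proof.
move=> z; rewrite /state z /right_states; case: (boolP (tri e)) => [/thead ->|_].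
  by case: ifP => _; last rewrite inE //; case: ifP => _; rewrite inE.
by case: ifP => _; rewrite !inE.
Qed.

Let state_left e : cl (head (next e)) == 0 ->
  state e \in left_states (tri e) (cl (head (next (rev (next e)))))
    (tri (next (rev (next e)))) (cl (head (next (next (rev (next e)))))).
Proof.
move=> z; rewrite /state z /left_states; case: (boolP (tri e)) => [t|_]; last first.
  by case: ifP => _; rewrite !inE.
rewrite (tnext t) head_rev tail_prev tail_rev; set q := prev (rev e).
rewrite tri_rev; case: ifP => _; last by rewrite inE.
case: (boolP (tri (prev q))) => [tq|_]; last by rewrite inE.
rewrite -tri_rev in tq; have := thead tq; rewrite revK => ->.
by rewrite inE.
Qed.

Let dem_le_link e : special (cl (tail e)) ->
  (dem (rev (next e)) <= link_demand (cl (tail e)) (state e) (state (next e)))%ZZ.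
Proof.
move=> sp; have [z|nz] := boolP (cl (head (next e)) == 0); last first.
  rewrite /dem tail_rev (negPf nz) /state (negPf nz).
  by case: ifP => _; case: ifP => _; rewrite /link_demand.
rewrite (dem_five z) tail_next nextK; apply: demand_le_link => //; try exact: cl14.
- have z' : cl (tail (rev (next e))) = 0 by rewrite tail_rev; apply/eqP.
  have := uncovered z'; rewrite /view head_rev tail_next.
  have e4 := five_prev z'.
  have e3 : next (next (next (rev (next e)))) = prev (prev (rev (next e))) by rewrite -e4 nextK.
  by rewrite e3 prevK.
- exact: state_left.
- exact: state_right.
Qed.

Lemma link_special w : special (cl w) ->
  (\sum_(e | tail e == w) dem (rev e) <=
   (Z.of_nat (dg w) - 6) * unit_charge + \sum_(e | tail e == w) gift e)%R.
Proof.
move=> sp.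
have [e0 t0] : exists e, tail e == w.
  have /card_gt0P[e] : 0 < dg w by apply: leq_trans (min_deg w).
  by exists e.
have re (F : D -> Z) : (\sum_(e | tail e == w) F (next e) = \sum_(e | tail e == w) F e)%R.
  rewrite [RHS](reindex_inj next_inj) /=; apply: eq_bigl => e; by rewrite tail_next.
rewrite -(re (fun e => dem (rev e))) -(re gift).
apply: (@le_trans _ _ (\sum_(e | tail e == w) (link_weight (cl w) (state e) (state (next e)) + gift (next e))%ZZ)%R).
  apply: ler_sum => e /eqP te; apply/ZleP.
  have := @dem_le_link e; rewrite te => /(_ sp) h; apply: Z.le_trans h _.
  rewrite /link_weight; case: ifP => [/eqP s14|_].
    suff -> : gift (next e) = half_unit by rewrite Z.sub_add; exact: Z.le_refl.
    move: s14; rewrite /gift /state; case: (tri (next e)) => //.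
    case: ifP => _; last by case: ifP.
    by case: ifP => // _; case: ifP => // _ c; have := cl14 (head (prev (prev (rev (next e))))); rewrite c.
  by rewrite -{1}[link_demand _ _ _]Z.add_0_r; apply: Zplus_le_compat_l; rewrite /gift; case: ifP.
have -> : (\sum_(e | tail e == w) (link_weight (cl w) (state e) (state (next e)) + gift (next e))%ZZ =
  \sum_(e | tail e == w) link_weight (cl w) (state e) (state (next e))
  + \sum_(e | tail e == w) gift (next e))%R by rewrite -big_split.
rewrite lerD2r.
move/eqP: t0 => t0; rewrite -{1}t0 sum_link t0.
pose st i := state (iter i next e0).
have st19 i : st i < 19 by exact: state_lt.
have stn : st (dg w) = st 0 by rewrite /st -{1}t0 iter_degree.
have cl_w : cl w = degree_class (dg w) by [].
have /and3P[k1 k2 k3] := check_link_true.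
case: (degree_class_special sp) => -[ec en].
- rewrite cl_w ec en in stn *; exact: link_closed_walk k1 st19 stn.
- rewrite cl_w ec en in stn *; exact: link_closed_walk k2 st19 stn.
- rewrite cl_w ec en in stn *; exact: link_closed_walk k3 st19 stn.
Qed.

Lemma link_bound w : cl w != 0 ->
  (\sum_(e | tail e == w) dem (rev e) <=
   (Z.of_nat (dg w) - 6) * unit_charge + \sum_(e | tail e == w) gift e)%R.
Proof.
rewrite degree_class0 -ltnNge => w5.
have [sp|ns] := boolP (special (cl w)); first exact: link_special.
apply: le_trans (link_generic w5 ns) _.
have -> : (\sum_(e | tail e == w) (corner_charge (cl w) + gift e)%ZZ =
   \sum_(e | tail e == w) corner_charge (cl w) + \sum_(e | tail e == w) gift e)%R.
  by rewrite -big_split.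
rewrite lerD2r sumr_const -/(dg w); apply/ZleP.
have -> : (corner_charge (cl w) *+ dg w)%R = (Z.of_nat (dg w) * corner_charge (cl w))%ZZ.
  by elim: (dg w) => [|n IH]; rewrite ?mulr0n// mulrS IH Nat2Z.inj_succ Z.mul_succ_l Z.add_comm.
exact: degree_corner_charge.
Qed.

Lemma dem_large w : cl w = 0 -> (\sum_(e | tail e == w) dem (rev e) = 0)%R.
Proof.
move=> z; rewrite big1// => e /eqP te.
have [zz|nz] := boolP (cl (head e) == 0); last by rewrite /dem tail_rev (negPf nz).
by rewrite (dem_five zz) te z /demand /corner_share /=; case: ifP => _; case: ifP.
Qed.

Lemma star_balance x : cl x = 0 ->
  (unit_charge <= \sum_(d | tail d == x) look net_gain d)%R.
Proof.
move=> z.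
have [d1 t1] : exists e, tail e == x.
  have /card_gt0P[e] : 0 < dg x by apply: leq_trans (min_deg x).
  by exists e.
(* The finite check only runs over tuples whose first class is the largest, so the rotation is
   started at such a neighbour. *)
case: (@arg_maxnP _ d1 (fun d => tail d == x) (fun d => cl (head d)) t1) => d /eqP td mx.
have zd : cl (tail d) = 0 by rewrite td.
rewrite -td sum_link.
have -> : dg (tail d) = 5.
  by move/eqP: zd; rewrite degree_class0; have := min_deg (tail d); lia.
rewrite !big_ord_recl big_ord0 /= addr0.
have mx' e : tail e = x -> cl (head e) <= cl (head d) by move=> te; apply: mx; rewrite te.
have := @balance_enough (cl (head d)) (cl (head (next d))) (cl (head (next (next d))))
  (cl (head (next (next (next d))))) (cl (head (next (next (next (next d))))))
  (tri d) (tri (next d)) (tri (next (next d))) (tri (next (next (next d))))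
  (tri (next (next (next (next d))))) (cl14 _).
rewrite !mx' ?tail_next// => /(_ isT isT isT isT (uncovered zd)).
have A (q0 q1 q2 q3 q4 : Z) : (unit_charge <= q0 + q1 + q2 + q3 + q4)%ZZ ->
    (unit_charge <= q0 + (q1 + (q2 + (q3 + q4))))%R by move=> /ZleP; rewrite !addrA.
by rewrite /balance /view !(five_cycle zd); exact: A.
Qed.

(** The difference of the two sides is twice the total initial charge, which cannot be negative:
    every 5-vertex gains the unit it lacks, and no other vertex gives more than it has. *)
Lemma discharging_contradiction :
  12 * #|T| <= 2 * #|D| + #|[pred d | ~~ tri d]|.
Proof.
have S1 : (\sum_(x | cl x == 0%N) unit_charge <= \sum_(d | cl (tail d) == 0%N) look net_gain d)%R.
  rewrite (partition_big tail (fun x => cl x == 0%N)) //=.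
  apply: ler_sum => x /eqP zx; apply: le_trans (star_balance zx) _.
  rewrite le_eqVlt; apply/orP; left; apply/eqP/eq_bigl => d.
  by case: (eqVneq (tail d) x) => [->|]; rewrite ?zx ?eqxx ?andbF.
have S2 : (\sum_(d | cl (tail d) == 0%N) look net_gain d <=
   \sum_(d | cl (tail d) == 0%N) dem d + \sum_(d | cl (tail d) == 0%N) gift d)%R.
  rewrite -big_split.
  have := claims_paid; rewrite -subr_ge0 -sumrB => h.
  rewrite -subr_ge0 -sumrB; apply: le_trans h _.
  apply: ler_sum => d z; apply/ZleP.
  rewrite /dem z /gift /view /net_gain /mirror /=; lia.
have S3 : (\sum_(d | cl (tail d) == 0%N) dem d = \sum_x \sum_(e | tail e == x) dem (rev e))%R.
  transitivity (\sum_d dem (rev d))%R; last by rewrite (partition_big tail predT) //=.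
  transitivity (\sum_d dem d)%R; last by rewrite [LHS](reindex_inj rev_inj).
  by rewrite big_mkcond; apply: eq_bigr => d _; rewrite /dem; case: (cl (tail d) == 0).
have S4 : (\sum_x \sum_(e | tail e == x) dem (rev e) <=
   \sum_(x | cl x != 0%N) (Z.of_nat (dg x) - 6) * unit_charge +
   \sum_(x | cl x != 0%N) \sum_(e | tail e == x) gift e)%R.
  rewrite -big_split.
  rewrite [X in (_ <= X)%R]big_mkcond; apply: ler_sum => x _.
  by case: ifP => [|/negbFE/eqP]; [exact: link_bound | move=> /dem_large ->].
have S5 : (\sum_d gift d = \sum_(d | cl (tail d) == 0%N) gift d +
    \sum_(x | cl x != 0%N) \sum_(e | tail e == x) gift e)%R.
  rewrite (bigID (fun d => cl (tail d) == 0%N)) /=; congr (_ + _)%R.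
  rewrite (partition_big tail (fun x => cl x != 0%N)) //=.
  apply: eq_bigr => x nx; apply: eq_bigl => d.
  by case: (eqVneq (tail d) x) => [->|]; rewrite ?nx ?andbF.
have S6 : (\sum_x (Z.of_nat (dg x) - 6) * unit_charge =
   - (\sum_(x | cl x == 0%N) unit_charge) +
   \sum_(x | cl x != 0%N) (Z.of_nat (dg x) - 6) * unit_charge)%R.
  rewrite (bigID (fun x => cl x == 0%N)) /=; congr (_ + _)%R.
  rewrite -sumrN; apply: eq_bigr => x z.
  by have -> : dg x = 5 by move: z; rewrite degree_class0; have := min_deg x; lia.
have S7 : (0 <= \sum_x (Z.of_nat (dg x) - 6) * unit_charge + \sum_d gift d)%R.
  rewrite S5 S6; rewrite S3 in S2.
  have := le_trans S1 S2; move: S4.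
  do 7?[move: (bigop _ _ _)]; lia.
have G1 : (\sum_d gift d = Z.of_nat #|[pred d | ~~ tri d]| * half_unit)%R.
  have -> : Z.of_nat #|[pred d | ~~ tri d]| = (\sum_i (if tri i then 0 else 1))%R.
    rewrite -sum1_card big_mkcond; elim/big_ind2: _ => // [x1 x2 y1 y2 <- <-|i _].
      by rewrite Nat2Z.inj_add.
    by rewrite inE; case: (tri i).
  by rewrite mulr_suml; apply: eq_bigr => i _; rewrite /gift; case: (tri i).
have G2 : (\sum_x (Z.of_nat (dg x) - 6) * unit_charge =
    (Z.of_nat #|D| - 6 * Z.of_nat #|T|)%ZZ * unit_charge)%R.
  rewrite -mulr_suml; congr (_ * _)%R.
  have -> : #|D| = \sum_x dg x.
    rewrite -sum1_card (partition_big tail predT) //=.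
    by apply: eq_bigr => x _; rewrite /dg -sum1_card.
  rewrite -[#|T|]sum1_card big_const iter_addn_0 mul1n.
  have -> : Z.of_nat (\sum_x dg x) = (\sum_x Z.of_nat (dg x))%R.
    by elim/big_ind2: _ => // x1 x2 y1 y2 <- <-; rewrite Nat2Z.inj_add.
  rewrite big_split /= sumr_const.
  have -> : (- 6 *+ #|T|)%R = (- (6 * Z.of_nat #|T|))%ZZ.
    by elim: #|T| => [|n IH]; rewrite ?mulr0n// mulrS IH; lia.
  by [].
move: S7; rewrite G1 G2 /unit_charge /half_unit => /ZleP.
move: #|T| #|D| #|_| => a b c; lia.
Qed.

End Discharging.

Section Drawings.
Local Open Scope classical_set_scope.
Local Open Scope ring_scope.

(** * Angle variation *)

(** Compactness of the segment, through the supremum of the reachable points, in the form used for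
    every passage from local to global: an additive property of subintervals holds if it holds near
    each point. *)
Lemma interval_induction (R : realType) (P : R -> R -> Prop) (a b : R) :
  a <= b ->
  (forall x y z, a <= x -> x <= y -> y <= z -> z <= b ->
     P x y -> P y z -> P x z) ->
  (forall t, a <= t <= b -> exists2 e, 0 < e & forall x y,
     a <= x -> x <= y -> y <= b -> t - e < x -> y < t + e -> P x y) ->
  P a b.
Proof.
move=> ab Padd Ploc.
pose S := [set t | a <= t <= b /\ P a t].
have Sa : S a.
  split; first by rewrite lexx.
  have [|e e0 He] := Ploc a; first by rewrite lexx.
  by apply: He => //; lra.
have Sub : ubound S b by move=> t [/andP[]].
have hS : has_sup S by split; [exists a | exists b].
have aS : a <= sup S by apply: sup_upper_bound.
have Sb : sup S <= b by apply: ge_sup => //; exists a.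
have [|e e0 He] := Ploc (sup S); first by rewrite aS Sb.
have [t [/andP[at_ tb] Pat] ht] := sup_adherent e0 hS.
have tS : t <= sup S by apply: sup_upper_bound => //; split => //; rewrite at_ tb.
pose m := Num.min (sup S + e / 2) b.
have tm : t <= m by rewrite /m le_min tb andbT; lra.
have mb : m <= b by rewrite /m ge_min lexx orbT.
have Pam : P a m.
  apply: (Padd a t m) => //; apply: He => //.
  by rewrite /m gt_min; apply/orP; left; lra.
have mS : m <= sup S.
  by apply: sup_upper_bound => //; split => //; rewrite mb (le_trans at_ tm).
have -> // : b = m.
apply/eqP; rewrite eq_le mb andbT; move: mS; rewrite /m.
by case: (leP (sup S + e / 2) b) => // ? ?; lra.
Qed.

Section Angles.
Variable R : realType.
Implicit Types (u v w p : R * R) (g : R -> R * R) (f : R -> R).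

Definition dot u v := u.1 * v.1 + u.2 * v.2.
Definition cross u v := u.1 * v.2 - u.2 * v.1.
Definition polar (r a : R) : R * R := (r * cos a, r * sin a).
(** The signed angle from [u] to [v]; it has this meaning only when [dot u v] is positive, since
    [atan] sees directions up to sign. *)
Definition ang u v := atan (cross u v / dot u v).

Lemma cos_gt0_pihalfW (x : R) : - pi < x < pi -> 0 < cos x -> - (pi / 2) < x < pi / 2.
Proof.
move=> /andP[x1 x2] c.
have nc (y : R) : pi / 2 <= y <= pi -> cos y <= 0.
  move=> /andP[y1 y2]; rewrite -[y](subrK (pi / 2)) cosDpihalf oppr_le0.
  by apply: sin_ge0_pi; apply/andP; have := pi_gt0 R; split; lra.
apply/andP; split; rewrite ltNge; apply/negP => h.
  by have := nc (- x); rewrite cosN => H; have := H ltac:(apply/andP; split; lra); lra.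
by have := nc x ltac:(apply/andP; split; lra); lra.
Qed.

Lemma ang_bound u v : - (pi / 2) < ang u v < pi / 2.
Proof. by rewrite atan_gtNpi2 atan_ltpi2. Qed.

Lemma cos_ang u v : 0 < cos (ang u v).
Proof. exact/cos_gt0_pihalf/ang_bound. Qed.

Lemma sin_ang u v : sin (ang u v) = cross u v / dot u v * cos (ang u v).
Proof.
rewrite -[X in X * _](atanK (cross u v / dot u v)) /tan mulfVK//.
by rewrite gt_eqF// cos_ang.
Qed.

Lemma ang_polar (r s a b : R) : 0 < r -> 0 < s -> - (pi / 2) < b - a < pi / 2 ->
  ang (polar r a) (polar s b) = b - a.
Proof.
move=> r0 s0 h; rewrite /ang -[RHS](@tanK R) ?in_itv//=; congr atan.
rewrite /tan sinB cosB /cross /dot /=.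
have -> : r * cos a * (s * sin b) - r * sin a * (s * cos b)
  = r * s * (sin b * cos a - cos b * sin a) by ring.
have -> : r * cos a * (s * cos b) + r * sin a * (s * sin b)
  = r * s * (cos b * cos a + sin b * sin a) by ring.
by rewrite -mulf_div divff ?mul1r// mulf_neq0 ?gt_eqF.
Qed.

Lemma polar_ang u v (r a : R) : 0 < r -> 0 < dot u v -> u = polar r a ->
  exists2 s, 0 < s & v = polar s (a + ang u v).
Proof.
move=> r0 d0 eu; have c0 := cos_ang u v.
exists (dot u v / (r * cos (ang u v))); first by rewrite divr_gt0// mulr_gt0.
have nc : cos (ang u v) != 0 by rewrite gt_eqF.
have nr : r != 0 by rewrite gt_eqF.
have nd : dot u v != 0 by rewrite gt_eqF.
have e2 := cos2Dsin2 a.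
rewrite /polar cosD sinD sin_ang [v in LHS]surjective_pairing; congr (_, _).
  have -> : dot u v / (r * cos (ang u v)) *
    (cos a * cos (ang u v) - sin a * (cross u v / dot u v * cos (ang u v)))
    = (dot u v * cos a - cross u v * sin a) / r by field; rewrite nr nc nd.
  rewrite {}eu /dot /cross /=.
  have -> : (r * cos a * v.1 + r * sin a * v.2) * cos a -
    (r * cos a * v.2 - r * sin a * v.1) * sin a = r * (v.1 * (cos a ^+ 2 + sin a ^+ 2)) by ring.
  by rewrite e2 mulr1 mulrC mulKf.
have -> : dot u v / (r * cos (ang u v)) *
  (sin a * cos (ang u v) + cos a * (cross u v / dot u v * cos (ang u v)))
  = (dot u v * sin a + cross u v * cos a) / r by field; rewrite nr nc nd.
rewrite {}eu /dot /cross /=.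
have -> : (r * cos a * v.1 + r * sin a * v.2) * sin a +
  (r * cos a * v.2 - r * sin a * v.1) * cos a = r * (v.2 * (cos a ^+ 2 + sin a ^+ 2)) by ring.
by rewrite e2 mulr1 mulrC mulKf.
Qed.

Lemma dot_polar (r s a b : R) : dot (polar r a) (polar s b) = r * s * cos (b - a).
Proof. by rewrite cosB /dot /=; ring. Qed.

Lemma dot_self_gt0 u : u != 0 -> 0 < dot u u.
Proof.
case: u => x y; rewrite -pair_eqE /= negb_and /dot /= -!expr2 => h.
have := sqr_ge0 x; have := sqr_ge0 y => hy hx.
by case/orP: h => h; [rewrite ltr_pwDl | rewrite ltr_wpDl]; rewrite // exprn_even_gt0.
Qed.

Lemma exists_polar u : u != 0 ->
  exists r a, [/\ 0 < r, 0 <= a < 2 * pi & u = polar r a].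
Proof.
move=> u0; have d0 := dot_self_gt0 u0.
pose r := Num.sqrt (dot u u).
have r0 : 0 < r by rewrite sqrtr_gt0.
have rr : r ^+ 2 = dot u u by rewrite sqr_sqrtr// ltW.
have xr : (u.1 / r) ^+ 2 + (u.2 / r) ^+ 2 = 1.
  rewrite !expr_div_n rr -mulrDl -[X in X / _]/(u.1 * u.1 + u.2 * u.2) divff// gt_eqF//.
have cb : -1 <= u.1 / r <= 1.
  rewrite -ler_norml -(@ler_pXn2r _ 2) ?nnegrE// expr1n real_normK ?num_real// -xr.
  by rewrite lerDl sqr_ge0.
have pi0 := pi_gt0 R.
have es : Num.sqrt (1 - (u.1 / r) ^+ 2) = `|u.2 / r|.
  by rewrite -xr addrAC subrr add0r sqrtr_sqr.
have mk x : r * (x / r) = x by rewrite mulrC mulfVK// gt_eqF.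
have /andP[a0 api] : 0 <= acos (u.1 / r) <= pi by rewrite acos_ge0// acos_lepi.
case: (leP 0 u.2) => h.
  exists r, (acos (u.1 / r)); split => //; first by rewrite a0; lra.
  rewrite /polar acosK// ?in_itv//= sin_acos// es ger0_norm ?divr_ge0// ?(ltW r0)//.
  by rewrite !mk -surjective_pairing.
have a0' : 0 < acos (u.1 / r).
  rewrite lt_neqAle a0 andbT eq_sym; apply/eqP => e.
  have := cos_max (0:R); have : cos (acos (u.1 / r)) = 1 by rewrite e cos0.
  rewrite acosK ?in_itv//= => e1 _; move: xr; rewrite e1 expr1n => e2.
  have : (u.2 / r) ^+ 2 = 0 by lra.
  move/eqP; rewrite expf_eq0 /= mulf_eq0 invr_eq0 => /orP[/eqP|/eqP]; lra.
exists r, (2 * pi - acos (u.1 / r)); split => //; first by apply/andP; split; lra.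
have -> : 2 * pi - acos (u.1 / r) = - acos (u.1 / r) + pi *+ 2 by rewrite mulr2n; ring.
rewrite /polar cosD2pi sinD2pi cosN sinN acosK// ?in_itv//= sin_acos// es.
rewrite ltr0_norm ?opprK; last by rewrite pmulr_llt0// invr_gt0.
by rewrite !mk -surjective_pairing.
Qed.

(** A priori the two sides agree up to a multiple of 2 pi. The right side lies in ]-pi, pi[, and its
    cosine is positive because [dot u v] is, so it lies in the range of [ang]. *)
Lemma ang_cocycle p u v : 0 < dot p u -> 0 < dot p v -> 0 < dot u v ->
  ang u v = ang p v - ang p u.
Proof.
move=> pu pv uv.
have p0 : p != 0.
  by apply/eqP => p0; move: pu; rewrite p0 /dot /= !mul0r addr0 ltxx.
have [r [a [r0 _ ep]]] := exists_polar p0.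
have [s s0 eu] := polar_ang r0 pu ep.
have [t t0 ev] := polar_ang r0 pv ep.
have /andP[u1 u2] := ang_bound p u; have /andP[v1 v2] := ang_bound p v.
rewrite {1}eu {1}ev ang_polar//; first by ring.
apply: cos_gt0_pihalfW; first by apply/andP; split; lra.
by move: uv; rewrite {1}eu {1}ev dot_polar pmulr_rgt0// mulr_gt0.
Qed.

Definition cone p u := `|cross p u| < dot p u.

Lemma cone_dot p u : cone p u -> 0 < dot p u.
Proof. by apply: le_lt_trans. Qed.

Lemma cone_near p : p != 0 -> exists2 e, 0 < e & forall u,
  `|u.1 - p.1| < e -> `|u.2 - p.2| < e -> cone p u.
Proof.
move=> p0; have d0 := dot_self_gt0 p0.
pose m := `|p.1| + `|p.2|.
have m0 : 0 <= m by rewrite addr_ge0.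
exists (dot p p / (2 * m + 1)); first by rewrite divr_gt0//; lra.
move=> u h1 h2; rewrite /cone.
set e := _ / _ in h1 h2.
have e0 : 0 < e by rewrite divr_gt0//; lra.
have em : e * m * 2 < dot p p.
  have : e * (2 * m + 1) = dot p p by rewrite /e mulfVK// gt_eqF//; lra.
  by lra.
have b1 : `|cross p u| <= e * m.
  have -> : cross p u = p.1 * (u.2 - p.2) - p.2 * (u.1 - p.1) by rewrite /cross; ring.
  apply: (le_trans (ler_normB _ _)); rewrite !normrM /m mulrDr.
  by rewrite lerD// mulrC ler_wpM2r// ltW.
have b2 : `|dot p u - dot p p| <= e * m.
  have -> : dot p u - dot p p = p.1 * (u.1 - p.1) + p.2 * (u.2 - p.2) by rewrite /dot; ring.
  apply: (le_trans (ler_normD _ _)); rewrite !normrM /m mulrDr.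
  by rewrite lerD// mulrC ler_wpM2r// ltW.
by move: b2; rewrite ler_norml => /andP[b2 _]; lra.
Qed.

Definition path_cont g (a b : R) := forall t, a <= t <= b -> forall e, 0 < e ->
  exists2 d, 0 < d & forall x, a <= x <= b -> `|x - t| < d ->
    `|(g x).1 - (g t).1| < e /\ `|(g x).2 - (g t).2| < e.

Definition path_ok g a b := path_cont g a b /\ forall t, a <= t <= b -> g t != 0.

(* f is a continuous argument of g up to a constant, expressed without continuity. *)
Definition is_lift g f (a b : R) := forall t, a <= t <= b ->
  exists2 e, 0 < e & forall x, a <= x <= b -> `|x - t| < e ->
    cone (g t) (g x) /\ f x - f t = ang (g t) (g x).

Lemma path_okW g a b c d : a <= c -> d <= b -> path_ok g a b -> path_ok g c d.
Proof.
move=> ac db [gc g0]; split=> t /andP[ct td].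
  move=> e e0; have [|d' d0 h] := gc t _ e e0; first by rewrite (le_trans ac)// (le_trans td).
  by exists d' => // x /andP[? ?]; apply: h; rewrite (le_trans ac)// (le_trans _ db).
by apply: g0; rewrite (le_trans ac)// (le_trans td).
Qed.

Lemma is_liftW g f a b c d : a <= c -> d <= b -> is_lift g f a b -> is_lift g f c d.
Proof.
move=> ac db L t /andP[ct td]; have [|e e0 h] := L t; first by rewrite (le_trans ac)// (le_trans td).
by exists e => // x /andP[? ?]; apply: h; rewrite (le_trans ac)// (le_trans _ db).
Qed.

Lemma lift_unique g f1 f2 a b : a <= b -> is_lift g f1 a b -> is_lift g f2 a b ->
  f1 b - f1 a = f2 b - f2 a.
Proof.
move=> ab L1 L2.
apply: (interval_induction (P := fun x y => f1 y - f1 x = f2 y - f2 x)) ab _ _.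
  by move=> x y z _ _ _ _; lra.
move=> t tab; have [e1 e10 h1] := L1 t tab; have [e2 e20 h2] := L2 t tab.
exists (Num.min e1 e2) => [|x y ax xy yb]; first by rewrite lt_min e10.
set e := Num.min _ _ => tx yt.
have [ee1 ee2] : e <= e1 /\ e <= e2 by rewrite /e !ge_min !lexx orbT.
have xx : `|x - t| < e by rewrite ltr_norml; apply/andP; split; lra.
have yy : `|y - t| < e by rewrite ltr_norml; apply/andP; split; lra.
have xab : a <= x <= b by rewrite ax (le_trans xy).
have yab : a <= y <= b by rewrite yb (le_trans ax).
have [_ X1] := h1 x xab (lt_le_trans xx ee1).
have [_ X2] := h2 x xab (lt_le_trans xx ee2).
have [_ Y1] := h1 y yab (lt_le_trans yy ee1).
have [_ Y2] := h2 y yab (lt_le_trans yy ee2).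
by lra.
Qed.

Lemma half_plane_lift p g a b : path_ok g a b ->
  (forall t, a <= t <= b -> 0 < dot p (g t)) -> is_lift g (fun t => ang p (g t)) a b.
Proof.
move=> [gc g0] hp t tab.
have [e e0 he] := cone_near (g0 t tab).
have [d d0 hd] := gc t tab e e0.
exists d => // x xab xt; have [x1 x2] := hd x xab xt.
have C := he _ x1 x2; split => //.
by rewrite [RHS](@ang_cocycle p) ?hp// cone_dot.
Qed.

Lemma lift_exists g a b : a <= b -> path_ok g a b -> exists f, is_lift g f a b.
Proof.
move=> ab gok.
apply: (interval_induction (P := fun x y => exists f, is_lift g f x y)) ab _ _.
  move=> x y z _ xy yz _ [f1 L1] [f2 L2].
  exists (fun t => if t <= y then f1 t else f2 t - f2 y + f1 y) => t /andP[xt tz].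
  have [ty|yt|ty] := ltgtP t y.
  - have [|e e0 h] := L1 t; first by rewrite xt ltW.
    exists (Num.min e (y - t)) => [|s /andP[xs sz]]; first by rewrite lt_min e0 subr_gt0.
    rewrite lt_min => /andP[se]; rewrite ltr_norml => /andP[_ st].
    have sy : s <= y by lra.
    rewrite sy; apply: h => //; exact/andP.
  - have [|e e0 h] := L2 t; first by rewrite tz ltW.
    exists (Num.min e (t - y)) => [|s /andP[xs sz]]; first by rewrite lt_min e0 subr_gt0.
    rewrite lt_min => /andP[se]; rewrite ltr_norml => /andP[st _].
    have sy : y < s by lra.
    rewrite leNgt sy /=.
    have [|c q] := h s _ se; first by rewrite sz ltW.
    by split => //; lra.
  - have [|e1 e10 h1] := L1 t; first by rewrite xt ty lexx.
    have [|e2 e20 h2] := L2 t; first by rewrite tz ty lexx.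
    exists (Num.min e1 e2) => [|s /andP[xs sz]]; first by rewrite lt_min e10.
    rewrite lt_min => /andP[se1 se2]; case: (leP s y) => sy.
      by apply: h1 => //; exact/andP.
    have [|c q] := h2 s _ se2; first by rewrite sz ltW.
    by split => //; move: q; rewrite ty; lra.
move=> t tab; have [gc g0] := gok.
have [e e0 he] := cone_near (g0 t tab).
have [d d0 hd] := gc t tab e e0.
exists d => // x y ax xy yb tx yt; exists (fun s => ang (g t) (g s)).
apply: half_plane_lift; first exact: path_okW gok.
move=> s /andP[xs sy]; apply: cone_dot.
have [||h1 h2] := hd s; first by rewrite (le_trans ax)// (le_trans sy).
  by rewrite ltr_norml; apply/andP; split; lra.
exact: he.
Qed.

(** Total change of the argument along [g]. The default 0 never occurs for a path that satisfies
    [path_ok], by [lift_exists]. *)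
Definition var g (a b : R) : R :=
  if pselect (exists f, is_lift g f a b) is left h
  then projT1 (cid h) b - projT1 (cid h) a else 0.

Lemma varE g f a b : a <= b -> is_lift g f a b -> var g a b = f b - f a.
Proof.
move=> ab L; rewrite /var; case: pselect => [h|[]]; last by exists f.
exact: (lift_unique ab (projT2 (cid h)) L).
Qed.

Lemma var_cat g a b c : a <= b -> b <= c -> path_ok g a c ->
  var g a c = var g a b + var g b c.
Proof.
move=> ab bc gok; have ac := le_trans ab bc.
have [f L] := lift_exists ac gok.
rewrite (varE ac L) (varE ab (is_liftW _ _ L))// (varE bc (is_liftW _ _ L))//; lra.
Qed.

Lemma var_opp g a b : a <= b -> path_ok g a b -> var (fun t => - g t) a b = var g a b.
Proof.
move=> ab gok; have [f L] := lift_exists ab gok.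
rewrite (varE ab L); apply: varE => // t tab; have [e e0 h] := L t tab.
exists e => // x xab xt; have [c q] := h x xab xt.
have ec : cross (- g t) (- g x) = cross (g t) (g x) by rewrite /cross /=; ring.
have ed : dot (- g t) (- g x) = dot (g t) (g x) by rewrite /dot /=; ring.
by rewrite /cone /ang ec ed.
Qed.

Lemma eq_var g1 g2 a b : a <= b -> path_ok g1 a b ->
  (forall t, a <= t <= b -> g1 t = g2 t) -> var g1 a b = var g2 a b.
Proof.
move=> ab gok e12; have [f L] := lift_exists ab gok.
rewrite (varE ab L); symmetry; apply: varE => // t tab; have [e e0 h] := L t tab.
by exists e => // x xab xt; rewrite -!e12//; exact: h.
Qed.

Lemma var_rev g a b : a <= b -> path_ok g a b ->
  var (fun t => g (1 - t)) (1 - b) (1 - a) = - var g a b.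
Proof.
move=> ab gok; have [f L] := lift_exists ab gok.
have ab' : 1 - b <= 1 - a by lra.
rewrite (varE ab L) (@varE _ (fun t => f (1 - t)))//.
  by rewrite !subKr opprB.
move=> t /andP[t1 t2]; have [|e e0 h] := L (1 - t); first by apply/andP; split; lra.
exists e => // x /andP[x1 x2] xt; apply: h; first by apply/andP; split; lra.
by rewrite opprB addrC addrA subrK -normrN opprB.
Qed.

Lemma var_half p g a b : a <= b -> path_ok g a b ->
  (forall t, a <= t <= b -> 0 < dot p (g t)) -> var g a b = ang p (g b) - ang p (g a).
Proof. by move=> ab gok hp; rewrite (varE ab (half_plane_lift gok hp)). Qed.

Lemma var_polar g a b (r th : R) : a <= b -> path_ok g a b -> 0 < r -> g a = polar r th ->
  exists2 s, 0 < s & g b = polar s (th + var g a b).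
Proof.
move=> ab gok r0 ga; have [f L] := lift_exists ab gok; rewrite (varE ab L).
have H : forall r th, 0 < r -> g a = polar r th ->
    exists2 s, 0 < s & g b = polar s (th + (f b - f a)).
  apply: (interval_induction (P := fun x y => forall r th, 0 < r -> g x = polar r th ->
    exists2 s, 0 < s & g y = polar s (th + (f y - f x)))) ab _ _.
    move=> x y z _ _ _ _ H1 H2 r' th' r0' gx.
    have [s s0 gy] := H1 _ _ r0' gx; have [s' s0' gz] := H2 _ _ s0 gy.
    by exists s' => //; rewrite gz; congr polar; lra.
  move=> t tab; have [e e0 h] := L t tab; exists e => // x y ax xy yb tx yt r' th' r0' gx.
  have [||cx fx] := h x; first by rewrite ax (le_trans xy).
    by rewrite ltr_norml; apply/andP; split; lra.
  have [||cy fy] := h y; first by rewrite yb (le_trans ax).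
    by rewrite ltr_norml; apply/andP; split; lra.
  have dC u v : dot u v = dot v u by rewrite /dot; ring.
  have aC u v : ang u v = - ang v u.
    rewrite /ang -atanN -mulNr dC; congr (atan (_ / _)); rewrite /cross; ring.
  have dxt : 0 < dot (g x) (g t) by rewrite dC; exact: cone_dot.
  have [s s0 gt] := polar_ang r0' dxt gx.
  have [s' s0' gy] := polar_ang s0 (cone_dot cy) gt.
  exists s' => //; rewrite gy; congr polar; rewrite [ang (g x) _]aC; lra.
exact: H ga.
Qed.

End Angles.

(** * Turning along the boundary of a rectangle *)

Section Rectangle.
Variable R : realType.
Variable F : R -> R -> R * R.

Definition cont2 (a b c d : R) := forall s t, a <= s <= b -> c <= t <= d ->
  forall e, 0 < e -> exists2 dl, 0 < dl & forall s' t', a <= s' <= b -> c <= t' <= d ->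
    `|s' - s| < dl -> `|t' - t| < dl ->
    `|(F s' t').1 - (F s t).1| < e /\ `|(F s' t').2 - (F s t).2| < e.

Definition rect_ok a b c d := cont2 a b c d /\
  forall s t, a <= s <= b -> c <= t <= d -> F s t != 0.

Lemma rect_okW a b c d a' b' c' d' : a <= a' -> b' <= b -> c <= c' -> d' <= d ->
  rect_ok a b c d -> rect_ok a' b' c' d'.
Proof.
move=> aa bb cc dd [Fc F0].
have W (x y x' y' z : R) : x <= x' -> y' <= y -> x' <= z <= y' -> x <= z <= y.
  by move=> ? ? /andP[? ?]; apply/andP; split; lra.
split=> s t /(W _ _ _ _ _ aa bb) hs /(W _ _ _ _ _ cc dd) ht; last exact: F0.
move=> e e0; have [dl dl0 h] := Fc s t hs ht e e0; exists dl => // s' t' hs' ht'.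
by apply: h; [exact: W hs' | exact: W ht'].
Qed.

Lemma rect_ok_v a b c d s : rect_ok a b c d -> a <= s <= b -> path_ok (F s) c d.
Proof.
move=> [Fc F0] hs; split=> t ht; last exact: F0.
move=> e e0; have [dl dl0 h] := Fc s t hs ht e e0; exists dl => // x hx xt.
by apply: h => //; rewrite subrr normr0.
Qed.

Lemma rect_ok_h a b c d t : rect_ok a b c d -> c <= t <= d -> path_ok (F ^~ t) a b.
Proof.
move=> [Fc F0] ht; split=> s hs; last exact: F0.
move=> e e0; have [dl dl0 h] := Fc s t hs ht e e0; exists dl => // x hx xt.
by apply: h => //; rewrite subrr normr0.
Qed.

(** The identity is additive in both directions, so it is enough to prove it for small rectangles.
    There all values of [F] lie in one open half-plane, each variation is a difference of two values
    of [ang], and the corners cancel. *)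
Lemma var_rectangle a b c d : a <= b -> c <= d -> rect_ok a b c d ->
  var (F a) c d + var (F ^~ d) a b = var (F ^~ c) a b + var (F b) c d.
Proof.
move=> ab cd ok.
pose Q x y z w := var (F x) z w + var (F ^~ w) x y = var (F ^~ z) x y + var (F y) z w.
apply: (interval_induction (P := fun x y => Q x y c d)) ab _ _.
  move=> x y z ax xy yz zb; rewrite /Q.
  rewrite (@var_cat _ (F ^~ d) x y z)// ?(@var_cat _ (F ^~ c) x y z)//; last 2 first.
  - by apply: (rect_ok_h (rect_okW ax zb (lexx c) (lexx d) ok)); rewrite lexx.
  - by apply: (rect_ok_h (rect_okW ax zb (lexx c) (lexx d) ok)); rewrite lexx andbT.
  lra.
move=> s0 hs0.
(* The width of the strip around [s0] belongs to the property proved by induction along the strip,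
   as in the tube lemma: gluing two pieces takes the smaller width. *)
apply: (interval_induction (P := fun z w => exists2 e, 0 < e & forall x y,
     a <= x -> x <= y -> y <= b -> s0 - e < x -> y < s0 + e -> Q x y z w)) cd _ _.
  move=> x y z cx xy yz zd [e1 e10 h1] [e2 e20 h2].
  exists (Num.min e1 e2) => [|u v au uv vb]; first by rewrite lt_min e10.
  set e := Num.min _ _ => su vs.
  have [ee1 ee2] : e <= e1 /\ e <= e2 by rewrite /e !ge_min !lexx orbT.
  have := h1 u v au uv vb ltac:(lra) ltac:(lra).
  have := h2 u v au uv vb ltac:(lra) ltac:(lra); rewrite /Q.
  have ok' := rect_okW au vb cx zd ok.
  rewrite (@var_cat _ (F u) x y z)// ?(@var_cat _ (F v) x y z)//; last 2 first.
  - by apply: (rect_ok_v ok'); rewrite !lexx ?andbT /=.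
  - by apply: (rect_ok_v ok'); rewrite !lexx ?andbT /=.
  by lra.
move=> t0 ht0; have [Fc F0] := ok.
have [e e0 he] := cone_near (F0 _ _ hs0 ht0).
have [dl dl0 h] := Fc _ _ hs0 ht0 e e0.
exists dl => // z w cz zw wd tz wt; exists dl => // x y ax xy yb sx ys.
have ok' := rect_okW ax yb cz wd ok.
have hp s t : x <= s <= y -> z <= t <= w -> 0 < dot (F s0 t0) (F s t).
  move=> /andP[xs sy] /andP[zt tw]; apply: cone_dot.
  have [||||h1 h2] := h s t; last exact: he.
  - by rewrite (le_trans ax)// (le_trans sy).
  - by rewrite (le_trans cz)// (le_trans tw).
  - by rewrite ltr_norml; apply/andP; split; lra.
  - by rewrite ltr_norml; apply/andP; split; lra.
have xx : x <= x <= y by rewrite lexx.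
have yy : x <= y <= y by rewrite lexx xy.
have zz : z <= z <= w by rewrite lexx.
have ww : z <= w <= w by rewrite lexx zw.
rewrite /Q (var_half zw (rect_ok_v ok' xx) (hp _ ^~ xx))//.
rewrite (var_half zw (rect_ok_v ok' yy) (p := F s0 t0)) => [|t]; last exact: hp.
rewrite (var_half xy (rect_ok_h ok' zz) (p := F s0 t0)) => [|t ?]; last exact: hp.
rewrite (var_half xy (rect_ok_h ok' ww) (p := F s0 t0)) => [|t ?]; last exact: hp.
lra.
Qed.

End Rectangle.

(** * Turning at a common endpoint *)

Section MoreAngles.
Variable R : realType.
Implicit Types (u v w p : R * R) (g : R -> R * R).

Lemma polar_period (r a : R) (k : int) : polar r (a + k%:~R * (2 * pi)) = polar r a.
Proof.
have H (n : nat) (b : R) : polar r (b + n%:R * (2 * pi)) = polar r b.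
  have -> : n%:R * (2 * pi) = pi *+ 2 *+ n :> R by rewrite -[RHS]mulr_natl -(mulr_natl pi).
  by rewrite /polar (periodicn (@cosD2pi R)) (periodicn (@sinD2pi R)).
case: k => n; first exact: H.
rewrite NegzE -[in RHS](subrK (n.+1%:R * (2 * pi)) a) H; congr polar.
by rewrite mulrNz mulNr.
Qed.

Lemma angle_normalize (a b : R) : exists k : int, 0 <= b + k%:~R * (2 * pi) - a < 2 * pi.
Proof.
have pi0 := pi_gt0 R; have pp : 0 < 2 * pi :> R by lra.
exists (- Num.floor ((b - a) / (2 * pi))).
have /andP[] := floor_itv ((b - a) / (2 * pi)).
rewrite ler_pdivlMr// ltr_pdivrMr// mulrNz intrD mulr1z => h1 h2.
by apply/andP; split; lra.
Qed.

Lemma dot_polar_self (r a : R) : dot (polar r a) (polar r a) = r ^+ 2.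
Proof. by rewrite dot_polar subrr cos0 mulr1 expr2. Qed.

Lemma polar_inj (r s a b : R) : 0 < r -> 0 < s -> polar r a = polar s b ->
  [/\ r = s, cos a = cos b & sin a = sin b].
Proof.
move=> r0 s0 e; have : r = s.
  apply/eqP; rewrite -(@eqrXn2 _ 2) ?ltW//; apply/eqP.
  by rewrite -(dot_polar_self r a) e dot_polar_self.
move=> rs; move: e; rewrite rs => -[] /(mulfI (lt0r_neq0 s0)) -> /(mulfI (lt0r_neq0 s0)) ->.
by [].
Qed.

Lemma polar_shift (r s t a b v : R) : 0 < r -> 0 < s -> polar r (a + v) = polar s b ->
  polar t a = polar t (b - v).
Proof.
move=> r0 s0 /(polar_inj r0 s0)[_ c s'].
rewrite -[a in LHS](addrK v) /polar !cosB !sinB.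
by rewrite c s'.
Qed.

Lemma ang_refl u : ang u u = 0.
Proof.
have e : cross u u = 0 by rewrite /cross; ring.
by rewrite /ang e mul0r atan0.
Qed.

Lemma chord_polar (r a b : R) :
  polar r b - polar r a = polar (2 * r * sin ((b - a) / 2)) ((a + b) / 2 + pi / 2).
Proof.
have -> : b = (a + b) / 2 + (b - a) / 2 by lra.
set m := (a + b) / 2; set h := (b - a) / 2.
have -> : a = m - h by rewrite /m /h; lra.
have -> : (m + h - (m - h)) / 2 = h by lra.
have -> : (m - h + (m + h)) / 2 = m by lra.
rewrite /polar cosDpihalf sinDpihalf !cosD !sinD cosN sinN.
by apply/pair_equal_spec; split; rewrite /=; ring.
Qed.

Lemma dot_chord_lt u v (r : R) : dot v v = r ^+ 2 -> dot u u <= r ^+ 2 -> u != v ->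
  dot v u < r ^+ 2.
Proof.
move=> vv uu uv; have : 0 < dot (u - v) (u - v) by rewrite dot_self_gt0// subr_eq0.
have -> : dot (u - v) (u - v) = dot u u + dot v v - 2 * dot v u by rewrite /dot /=; ring.
by rewrite vv; lra.
Qed.

(* Both pieces of the path stay in a half-plane, because the disc of radius r is strictly
   convex, so the variation only depends on the directions of the chord and of the radii. *)
Lemma corner_turn g1 g2 (s0 t0 r a b : R) : 0 < r -> 0 <= s0 -> 0 <= t0 ->
  path_ok (fun t => g2 t - g1 s0) 0 t0 -> path_ok (fun s => g2 t0 - g1 s) 0 s0 ->
  g1 0 = 0 -> g2 0 = 0 ->
  g1 s0 = polar r a -> g2 t0 = polar r b -> a < b < a + 2 * pi ->
  (forall s, 0 <= s <= s0 -> dot (g1 s) (g1 s) <= r ^+ 2) ->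
  (forall t, 0 <= t <= t0 -> dot (g2 t) (g2 t) <= r ^+ 2) ->
  var (fun t => g2 t - g1 s0) 0 t0 - var (fun s => g2 t0 - g1 s) 0 s0 = b - a - pi.
Proof.
move=> r0 s00 t00 ok2 ok1 g10 g20 e1 e2 /andP[ab ba] le1 le2.
have pi0 := pi_gt0 R.
have n2 t : 0 <= t <= t0 -> g2 t - g1 s0 != 0 by case: ok2 => _; apply.
have n1 s : 0 <= s <= s0 -> g2 t0 - g1 s != 0 by case: ok1 => _; apply.
rewrite (@var_half _ (- g1 s0))//; last first.
  move=> t ht; have := @dot_chord_lt (g2 t) (g1 s0) r _ (le2 _ ht).
  rewrite e1 dot_polar_self -{1}e1 -subr_eq0 n2// => /(_ erefl isT).
  have -> : dot (- polar r a) (g2 t - polar r a) = dot (polar r a) (polar r a) - dot (polar r a) (g2 t).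
    by rewrite /dot /=; ring.
  by rewrite dot_polar_self; lra.
rewrite (@var_half _ (g2 t0))//; last first.
  move=> s hs; have := @dot_chord_lt (g1 s) (g2 t0) r _ (le1 _ hs).
  rewrite e2 dot_polar_self -{1}e2 eq_sym -subr_eq0 n1// => /(_ erefl isT).
  have -> : dot (polar r b) (polar r b - g1 s) = dot (polar r b) (polar r b) - dot (polar r b) (g1 s).
    by rewrite /dot /=; ring.
  by rewrite dot_polar_self; lra.
rewrite g10 g20 sub0r subr0 !ang_refl !subr0 e1 e2 chord_polar.
have -> : - polar r a = polar r (a + pi) by rewrite /polar cosDpi sinDpi !mulrN.
have sp : 0 < 2 * r * sin ((b - a) / 2).
  by rewrite mulr_gt0 ?mulr_gt0// sin_gt0_pi//; apply/andP; split; lra.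
rewrite !ang_polar//; by [lra | apply/andP; split; lra].
Qed.

End MoreAngles.

Section LShape.
Variable R : realType.
Variable F : R -> R -> R * R.

(** [F] may vanish at (0, 0), where two arcs with a common endpoint start. Without the corner [0, s[
    x [0, t[ the rectangle is the union of [s, S] x [0, T] and [0, s] x [t, T], to which
    [var_rectangle] applies. *)
Lemma var_Lshape (S T s t : R) : 0 < s <= S -> 0 < t <= T -> cont2 F 0 S 0 T ->
  (forall x y, 0 <= x <= S -> 0 <= y <= T -> (0 < x) || (0 < y) -> F x y != 0) ->
  var (F S) 0 T - var (F ^~ T) 0 S =
  (var (F s) 0 t - var (F ^~ t) 0 s) + var (F 0) t T - var (F ^~ 0) s S.
Proof.
move=> /andP[s0 sS] /andP[t0 tT] Fc F0.
have W (x y x' y' z : R) : x <= x' -> y' <= y -> x' <= z <= y' -> x <= z <= y.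
  by move=> ? ? /andP[? ?]; apply/andP; split; lra.
have ok1 : rect_ok F s S 0 T.
  split=> [x y hx hy e e0|x y hx hy].
    have hx' := W 0 _ _ _ _ (ltW s0) (lexx S) hx.
    have [d d0 h] := Fc _ _ hx' hy e e0; exists d => // x' y' hx'' hy'; apply: h => //.
    exact: W (ltW s0) (lexx S) hx''.
  by apply: F0 => //; [exact: W (ltW s0) (lexx S) hx | case/andP: hx => h _; rewrite (lt_le_trans s0 h)].
have ok2 : rect_ok F 0 s t T.
  split=> [x y hx hy e e0|x y hx hy].
    have hx' := W 0 S _ _ _ (lexx 0) sS hx.
    have hy' := W 0 T _ _ _ (ltW t0) (lexx T) hy.
    have [d d0 h] := Fc _ _ hx' hy' e e0; exists d => // x' y' hx'' hy''; apply: h.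
      exact: W (lexx 0) sS hx''.
    exact: W (ltW t0) (lexx T) hy''.
  apply: F0; [exact: W (lexx 0) sS hx | exact: W (ltW t0) (lexx T) hy | ].
  by case/andP: hy => h _; rewrite (lt_le_trans t0 h) orbT.
have T0 : 0 <= T by lra.
have E1 := var_rectangle sS T0 ok1.
have E2 := var_rectangle (ltW s0) tT ok2.
have okT : path_ok (F ^~ T) 0 S.
  split=> [x hx e e0|x hx].
    have [|d d0 h] := Fc x T hx _ e e0; first by rewrite lexx T0.
    by exists d => // x' hx' xx; apply: h; rewrite ?lexx ?T0// subrr normr0.
  by apply: F0; rewrite ?lexx ?T0// (lt_le_trans t0 tT) orbT.
have oks : path_ok (F s) 0 T by apply: (rect_ok_v ok1); rewrite lexx sS.
rewrite (@var_cat _ (F ^~ T) 0 s S) ?(ltW s0)//.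
move: E1; rewrite (@var_cat _ (F s) 0 t T) ?(ltW t0)// => E1.
lra.
Qed.

End LShape.

(** * First hit of a circle *)

Section FirstTime.
Variable R : realType.

Lemma dot_continuous (g : R -> R * R) (a b : R) : path_cont g a b ->
  forall t, a <= t <= b -> forall e, 0 < e -> exists2 d, 0 < d &
    forall x, a <= x <= b -> `|x - t| < d ->
      `|dot (g x) (g x) - dot (g t) (g t)| < e.
Proof.
move=> gc t tab e e0.
pose m := `|(g t).1| + `|(g t).2|; have m0 : 0 <= m by rewrite addr_ge0.
pose k := 2 * m + 3; have k0 : 0 < k by rewrite /k; lra.
have [d d0 h] := gc t tab (Num.min 1 (e / k)) ltac:(by rewrite lt_min ltr01 divr_gt0).
exists d => // x xab xt; have := h x xab xt.
rewrite !lt_min => -[/andP[a1 b1] /andP[a2 b2]].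
set c := e / k in b1 b2; have ck : c * k = e by rewrite mulfVK// gt_eqF.
have c0 : 0 < c by rewrite divr_gt0.
have H (y z : R) : `|y - z| < 1 -> `|y - z| < c -> `|y * y - z * z| <= c * (2 * `|z| + 1).
  move=> h1 h2; have -> : y * y - z * z = (y - z) * (y + z) by ring.
  rewrite normrM; apply: ler_pM => //; first exact: ltW.
  have -> : y + z = (y - z) + (z + z) by ring.
  apply: (le_trans (ler_normD _ _)); apply: (@le_trans _ _ (1 + (`|z| + `|z|))); last lra.
  by rewrite lerD// ?ler_normD// ltW.
have -> : dot (g x) (g x) - dot (g t) (g t) = ((g x).1 * (g x).1 - (g t).1 * (g t).1)
  + ((g x).2 * (g x).2 - (g t).2 * (g t).2) by rewrite /dot; ring.
apply: (le_lt_trans (ler_normD _ _)).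
apply: (le_lt_trans (lerD (H _ _ a1 b1) (H _ _ a2 b2))).
rewrite -ck -mulrDr ltr_pM2l// /k /m; lra.
Qed.

Lemma first_time (g : R -> R * R) (r : R) : 0 < r -> path_cont g 0 1 -> g 0 = 0 ->
  r ^+ 2 < dot (g 1) (g 1) ->
  exists t, [/\ 0 < t < 1, dot (g t) (g t) = r ^+ 2 &
    forall s, 0 <= s < t -> dot (g s) (g s) < r ^+ 2].
Proof.
move=> r0 gc g0 g1.
pose rho t := dot (g t) (g t); have rc := dot_continuous gc.
have rho0 : rho 0 < r ^+ 2 by rewrite /rho g0 /dot /= mul0r addr0 exprn_gt0.
pose S := [set t | 0 <= t <= 1 /\ forall s, 0 <= s <= t -> rho s < r ^+ 2].
have S0 : S 0.
  by split; [rewrite lexx ler01 | move=> s; rewrite -eq_le => /eqP <-].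
have S1 : ubound S 1 by move=> t [/andP[]].
have hS : has_sup S by split; [exists 0 | exists 1].
pose t := sup S.
have t0 : 0 <= t by apply: sup_upper_bound.
have t1 : t <= 1 by apply: ge_sup => //; exists 0.
have tab : 0 <= t <= 1 by rewrite t0 t1.
have below s : 0 <= s < t -> rho s < r ^+ 2.
  move=> /andP[s0 st]; have [|u [_ hu] us] := sup_adherent (_ : 0 < t - s) hS.
    by rewrite subr_gt0.
  by apply: hu; rewrite s0; move: us; rewrite -/t; lra.
have ge : r ^+ 2 <= rho t.
  rewrite leNgt; apply/negP => lt.
  have [d d0 h] := rc t tab (r ^+ 2 - rho t) ltac:(lra).
  have near x : 0 <= x <= 1 -> `|x - t| < d -> rho x < r ^+ 2.
    by move=> /h /[apply]; rewrite ltr_norml -/(rho x) -/(rho t) => /andP[]; lra.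
  have t1' : t < 1.
    rewrite lt_neqAle t1 andbT; apply/eqP => t1'; move: lt; rewrite t1' /rho; lra.
  pose u := Num.min 1 (t + d / 2).
  have tu : t < u by rewrite /u lt_min t1' /=; lra.
  have u1 : u <= 1 by rewrite /u ge_min lexx.
  have ud : u <= t + d / 2 by rewrite /u ge_min lexx orbT.
  have : u <= t; last lra.
  apply: sup_upper_bound => //; split; first by rewrite u1; lra.
  move=> s /andP[s0 su]; case: (ltP s t) => st; first by apply: below; rewrite s0.
  apply: near; first by apply/andP; split; lra.
  by rewrite ltr_norml; apply/andP; split; lra.
have t0' : 0 < t.
  by rewrite lt_neqAle t0 andbT; apply/eqP => t0'; move: ge; rewrite -t0'; lra.
have le : rho t <= r ^+ 2.
  rewrite leNgt; apply/negP => lt.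
  have [d d0 h] := rc t tab (rho t - r ^+ 2) ltac:(lra).
  pose u := Num.max 0 (t - d / 2).
  have ut : u < t by rewrite /u gt_max t0' /=; lra.
  have u0 : 0 <= u by rewrite /u le_max lexx.
  have ud : t - d / 2 <= u by rewrite /u le_max lexx orbT.
  have := h u ltac:(apply/andP; split; lra) ltac:(by rewrite ltr_norml; apply/andP; split; lra).
  rewrite ltr_norml -/(rho u) -/(rho t) => /andP[+ _].
  by have := below u ltac:(by rewrite u0); lra.
exists t; split; last exact: below.
  rewrite t0' lt_neqAle t1 andbT /=; apply/eqP => e; move: le; rewrite e /rho; lra.
by apply/eqP; rewrite eq_le le ge.
Qed.

End FirstTime.

(** * Arcs of a drawing *)

(** The witness 1/(1 + sum of 1/f i) also serves for an empty index type. *)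
Lemma finite_lower_bound (R : realType) (I : finType) (f : I -> R) :
  (forall i, 0 < f i) -> exists2 r, 0 < r <= 1 & forall i, r < f i.
Proof.
move=> f0; pose s := \sum_i (f i)^-1.
have s0 : 0 <= s by apply: sumr_ge0 => i _; rewrite invr_ge0 ltW.
exists (1 + s)^-1; first by rewrite invr_gt0 invf_le1; lra.
move=> i; rewrite -[f i]invrK ltf_pV2 ?posrE ?invr_gt0//; last lra.
rewrite /s (bigD1 i)//=; set q := \sum_(_ | _) _.
suff : 0 <= q by lra.
by apply: sumr_ge0 => j _; rewrite invr_ge0 ltW.
Qed.

Lemma path_cont_diff (R : realType) (g1 g2 : R -> R * R) (a b c d : R) :
  path_cont g1 a b -> path_cont g2 c d -> cont2 (fun s t => g2 t - g1 s) a b c d.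
Proof.
move=> c1 c2 s t hs ht e e0.
have [d1 d10 h1] := c1 s hs (e / 2) ltac:(lra).
have [d2 d20 h2] := c2 t ht (e / 2) ltac:(lra).
exists (Num.min d1 d2); first by rewrite lt_min d10.
move=> s' t' hs' ht'; rewrite !lt_min => /andP[a1 a2] /andP[b1 b2].
have [x1 x2] := h1 _ hs' a1; have [y1 y2] := h2 _ ht' b2.
move: x1 x2 y1 y2; rewrite /= !ltr_norml.
by move=> /andP[? ?] /andP[? ?] /andP[? ?] /andP[? ?]; split; apply/andP; split; lra.
Qed.

Lemma path_contB (R : realType) (g : R -> R * R) (p : R * R) (a b : R) :
  path_cont g a b -> path_cont (fun t => g t - p) a b.
Proof.
move=> gc t ht e e0; have [d d0 h] := gc t ht e e0; exists d => // x hx xt.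
have [h1 h2] := h x hx xt; split.
  by rewrite (_ : (g x - p).1 - _ = (g x).1 - (g t).1)//=; ring.
by rewrite (_ : (g x - p).2 - _ = (g x).2 - (g t).2)//=; ring.
Qed.

Section Drawing.
Variables (R : realType) (T : finType) (G : plane_graph R T).

Definition dart : finType := {p : T * T | adj G p.1 p.2}.
Implicit Types (d g : dart) (v : T).

Definition tail d := (val d).1.
Definition head d := (val d).2.
Definition arc d : R -> R * R := edge_arc G (tail d) (head d).

Lemma dart_adj d : adj G (tail d) (head d).
Proof. exact: valP d. Qed.

Lemma rev_subproof d : adj G (head d, tail d).1 (head d, tail d).2.
Proof. by rewrite /= adj_sym dart_adj. Qed.
Definition rev d : dart := exist _ (head d, tail d) (rev_subproof d).

Lemma tail_rev d : tail (rev d) = head d. Proof. by []. Qed.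
Lemma head_rev d : head (rev d) = tail d. Proof. by []. Qed.

Lemma dart_eq d g : tail d = tail g -> head d = head g -> d = g.
Proof.
by move=> e1 e2; apply: val_inj; rewrite [LHS]surjective_pairing [RHS]surjective_pairing; congr (_, _).
Qed.

Lemma revK : involutive rev.
Proof. by move=> d; apply: dart_eq. Qed.

Lemma tail_neq_head d : tail d != head d.
Proof. by apply/eqP => e; have := dart_adj d; rewrite e adj_irr. Qed.

Lemma rev_neq d : rev d != d.
Proof. by apply/eqP => /(congr1 tail) /eqP; rewrite eq_sym (negPf (tail_neq_head d)). Qed.

Lemma arc0 d : arc d 0 = pos G (tail d). Proof. exact/arc_start/dart_adj. Qed.
Lemma arc1 d : arc d 1 = pos G (head d). Proof. exact/arc_end/dart_adj. Qed.

Lemma arc_revE d t : 0 <= t <= 1 -> arc (rev d) t = arc d (1 - t).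
Proof. by move=> ht; apply: (arc_rev (dart_adj d)); rewrite in_itv. Qed.

Lemma arc_cont d : path_cont (arc d) 0 1.
Proof.
have /subspace_continuousP H := arc_continuous (dart_adj d).
move=> t ht e e0; have := H t; rewrite /= in_itv /= => /(_ ht) Ht.
have := @cvgr_dist_lt _ _ _ _ _ _ _ Ht _ e0.
move=> /(_ (within_filter _ _)); rewrite near_withinE -nbhs_nearE => /(@nbhs_ballP R R t)[dl /= dl0 h]; exists dl => // x hx xt.
have := h x; rewrite /= /ball /= distrC => /(_ xt).
rewrite in_itv /= => /(_ hx); rewrite prod_normE gt_max => /andP[h1 h2].
by rewrite -normrN opprB; split => //; rewrite -normrN opprB.
Qed.

Lemma arc_hits_vertex d v t : 0 <= t <= 1 -> arc d t = pos G v ->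
  (t = 0 /\ v = tail d) \/ (t = 1 /\ v = head d).
Proof.
move=> /andP[t0 t1] e.
have [z|z] := eqVneq t 0.
  by left; split => //; apply: (@pos_inj _ _ G); rewrite -e z arc0.
have [z1|z1] := eqVneq t 1.
  by right; split => //; apply: (@pos_inj _ _ G); rewrite -e z1 arc1.
by case: (@arc_vertex _ _ G _ _ v (dart_adj d) t) => //;
  rewrite in_itv /= !lt_neqAle t0 t1 eq_sym z z1.
Qed.

Lemma arc_meet d g s t : g != d -> g != rev d -> 0 <= s <= 1 -> 0 <= t <= 1 ->
  arc d s = arc g t -> (s = 0 \/ s = 1) /\ (t = 0 \/ t = 1).
Proof.
move=> gd gr hs ht e.
have E : s = 0 \/ s = 1 -> (s = 0 \/ s = 1) /\ (t = 0 \/ t = 1).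
  move=> h; split=> //; case: h => h; move: e; rewrite h ?arc0 ?arc1 => /esym /(arc_hits_vertex ht);
  by move=> [[? _]|[? _]]; [left | right].
have E' : t = 0 \/ t = 1 -> (s = 0 \/ s = 1) /\ (t = 0 \/ t = 1).
  move=> h; split=> //; case: h => h; move: e; rewrite h ?arc0 ?arc1 => /(arc_hits_vertex hs);
  by move=> [[? _]|[? _]]; [left | right].
have [s0|s0] := eqVneq s 0; first by apply: E; left.
have [s1|s1] := eqVneq s 1; first by apply: E; right.
have [t0|t0] := eqVneq t 0; first by apply: E'; left.
have [t1|t1] := eqVneq t 1; first by apply: E'; right.
case/andP: hs => hs0 hs1; case/andP: ht => ht0 ht1.
case: (@arc_nocross _ _ G _ _ _ _ (dart_adj d) (dart_adj g) s t) => //.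
- by rewrite in_itv /= !lt_neqAle hs0 hs1 eq_sym s0 s1.
- by rewrite in_itv /= !lt_neqAle ht0 ht1 eq_sym t0 t1.
- by case=> e1 e2; case/eqP: gd; apply: dart_eq.
- by case=> e1 e2; case/eqP: gr; apply: dart_eq.
Qed.

(** One circle size for all vertices, smaller than the distance between the ends of any edge: every
    arc has to cross the circle around its tail. *)
Lemma exists_radius : exists2 r : R, 0 < r & forall d,
  r ^+ 2 < dot (arc d 1 - arc d 0) (arc d 1 - arc d 0).
Proof.
have [|r /andP[r0 r1] h] := @finite_lower_bound R dart
   (fun d => dot (arc d 1 - arc d 0) (arc d 1 - arc d 0)).
  move=> d; rewrite dot_self_gt0// subr_eq0 arc0 arc1; apply/eqP => /(@pos_inj _ _ G) /eqP.
  by rewrite eq_sym (negPf (tail_neq_head d)).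
exists r => // d; apply: le_lt_trans (h d).
by rewrite expr2 ler_piMr// ltW.
Qed.

Definition radius : R := projT1 (cid2 exists_radius).
Lemma radius_gt0 : 0 < radius. Proof. by rewrite /radius; case: cid2. Qed.
Lemma radius_lt d : radius ^+ 2 < dot (arc d 1 - arc d 0) (arc d 1 - arc d 0).
Proof. by rewrite /radius; case: cid2. Qed.

Definition sarc d t := arc d t - pos G (tail d).

Lemma sarc0 d : sarc d 0 = 0. Proof. by rewrite /sarc arc0 subrr. Qed.

Lemma sarc_cont d : path_cont (sarc d) 0 1.
Proof. exact/path_contB/arc_cont. Qed.

Lemma sarc_neq0 d t : 0 < t <= 1 -> sarc d t != 0.
Proof.
move=> /andP[t0 t1]; rewrite subr_eq0; apply/eqP => /arc_hits_vertex.
rewrite (ltW t0) t1 => /(_ isT)[[/eqP]|[_ /eqP]]; first by rewrite gt_eqF.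
by rewrite (negPf (tail_neq_head d)).
Qed.

Lemma sarc_ok d t : 0 < t -> path_ok (sarc d) t 1.
Proof.
move=> t0; split=> [s /andP[ts s1] e e0|s /andP[ts s1]]; last first.
  by apply: sarc_neq0; rewrite s1 (lt_le_trans t0).
have [|dl dl0 h] := @sarc_cont d s _ e e0; first by rewrite s1 andbT; lra.
by exists dl => // x /andP[tx x1]; apply: h; rewrite x1 andbT; lra.
Qed.

Lemma exists_hit d (r : R) : 0 < r <= radius -> exists t, [/\ 0 < t < 1,
  dot (sarc d t) (sarc d t) = r ^+ 2 &
  forall s, 0 <= s < t -> dot (sarc d s) (sarc d s) < r ^+ 2].
Proof.
move=> /andP[r0 rr]; apply: first_time => //; [exact: sarc_cont | exact: sarc0 | ].
have := radius_lt d; rewrite arc0; apply: le_lt_trans.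
by rewrite ler_pXn2r// nnegrE ltW// radius_gt0.
Qed.

Definition hit d (r : R) : R :=
  if pselect (0 < r <= radius) is left h then projT1 (cid (exists_hit d h)) else 0.

Lemma hitP d (r : R) : 0 < r <= radius -> [/\ 0 < hit d r < 1,
  dot (sarc d (hit d r)) (sarc d (hit d r)) = r ^+ 2 &
  forall s, 0 <= s < hit d r -> dot (sarc d s) (sarc d s) < r ^+ 2].
Proof. by move=> h; rewrite /hit; case: pselect => // h'; case: cid. Qed.

Lemma hit_gt0 d r : 0 < r <= radius -> 0 < hit d r.
Proof. by move=> /(hitP d)[/andP[]]. Qed.
Lemma hit_lt1 d r : 0 < r <= radius -> hit d r < 1.
Proof. by move=> /(hitP d)[/andP[]]. Qed.

Lemma hit_le d r t : 0 < r <= radius -> 0 <= t <= hit d r -> dot (sarc d t) (sarc d t) <= r ^+ 2.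
Proof.
move=> /(hitP d)[_ e h] /andP[t0]; rewrite le_eqVlt => /orP[/eqP -> |tt]; first by rewrite e.
by apply/ltW/h; rewrite t0.
Qed.

Lemma radius_ok : 0 < radius <= radius. Proof. by rewrite radius_gt0 lexx. Qed.
Hint Resolve radius_ok : core.

Lemma hit_mono d r : 0 < r <= radius -> hit d r <= hit d radius.
Proof.
move=> hr; rewrite leNgt; apply/negP => h.
have [_ _ /(_ (hit d radius))] := hitP d hr.
rewrite h (ltW (hit_gt0 d radius_ok)) => /(_ isT).
have [_ -> _] := hitP d radius_ok; case/andP: hr => r0 rr.
by rewrite ltNge ler_pXn2r ?rr// nnegrE ltW// radius_gt0.
Qed.

Lemma sarc_hit_polar d : exists a, 0 <= a < 2 * pi /\ sarc d (hit d radius) = polar radius a.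
Proof.
have n0 : sarc d (hit d radius) != 0 by apply: sarc_neq0; rewrite hit_gt0// ltW ?hit_lt1.
have [s [a [s0 ha e]]] := exists_polar n0; exists a; split => //.
have [_ + _] := hitP d radius_ok; rewrite e dot_polar_self => /eqP.
by rewrite eqrXn2// ?ltW ?radius_gt0// => /eqP ->.
Qed.

Definition angle d : R := projT1 (cid (sarc_hit_polar d)).
Lemma angle_itv d : 0 <= angle d < 2 * pi.
Proof. by rewrite /angle; case: cid => ? []. Qed.
Lemma angleP d : sarc d (hit d radius) = polar radius (angle d).
Proof. by rewrite /angle; case: cid => ? []. Qed.

Definition angle_change d (r : R) := var (sarc d) (hit d r) (hit d radius).

Lemma sarc_hit_okW d r : 0 < r <= radius -> path_ok (sarc d) (hit d r) (hit d radius).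
Proof.
move=> hr; apply: path_okW (sarc_ok d (hit_gt0 d hr)); first exact: lexx.
by rewrite ltW// hit_lt1.
Qed.

Lemma sarc_hitE d (r a : R) : 0 < r <= radius -> sarc d (hit d radius) = polar radius a ->
  sarc d (hit d r) = polar r (a - angle_change d r).
Proof.
move=> hr ea; have r0 : 0 < r by case/andP: hr.
have n0 : sarc d (hit d r) != 0 by apply: sarc_neq0; rewrite hit_gt0// ltW ?hit_lt1.
have [s [b [s0 hb e]]] := exists_polar n0.
have sr : s = r.
  have [_ + _] := hitP d hr; rewrite e dot_polar_self => /eqP.
  by rewrite eqrXn2// ?ltW// => /eqP ->.
have [s' s'0 e'] := var_polar (hit_mono d hr) (sarc_hit_okW d hr) s0 e.
rewrite e sr; apply: (@polar_shift _ s' radius) => //; first exact: radius_gt0.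
by rewrite -e' ea.
Qed.

Lemma sarc_meet d g s t : tail d = tail g -> d != g -> 0 <= s <= 1 -> 0 <= t <= 1 ->
  (0 < s) || (0 < t) -> sarc d t - sarc g s != 0.
Proof.
move=> tt dg hs ht st; rewrite subr_eq0; apply/eqP => e.
have {}e : arc d t = arc g s.
  by move: e; rewrite /sarc tt => /(congr1 (fun x => x + pos G (tail g))); rewrite !subrK.
have gr : g != rev d.
  by apply/eqP => gr; have := tail_neq_head d; rewrite tt gr tail_rev eqxx.
have gd : g != d by rewrite eq_sym.
have [[t0|t1] [s0|s1]] := arc_meet gd gr ht hs e; move: e st.
- by rewrite t0 s0 ltxx.
- rewrite t0 s1 arc0 arc1 => /(@pos_inj _ _ G) e; have := tail_neq_head g.
  by rewrite -tt e eqxx.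
- rewrite t1 s0 arc0 arc1 => /(@pos_inj _ _ G) e; have := tail_neq_head d.
  by rewrite tt e eqxx.
- rewrite t1 s1 !arc1 => /(@pos_inj _ _ G) e; case/eqP: gd; exact: dart_eq.
Qed.

Lemma sarc_cont_le d t : t <= 1 -> path_cont (sarc d) 0 t.
Proof.
move=> t1 s /andP[s0 st] e e0.
have [|dl dl0 h] := @sarc_cont d s _ e e0; first by rewrite s0; lra.
by exists dl => // x /andP[x0 xt]; apply: h; rewrite x0; lra.
Qed.

Section Turn.
Variables (g d : dart).
Hypotheses (tt : tail d = tail g) (dg : d != g).
Let F s t := sarc d t - sarc g s.

Lemma turn_nonzero S U x y : S <= 1 -> U <= 1 -> 0 <= x <= S -> 0 <= y <= U ->
  (0 < x) || (0 < y) -> F x y != 0.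
Proof.
by move=> S1 U1 /andP[x0 xS] /andP[y0 yU] h; apply: sarc_meet => //; apply/andP; split; lra.
Qed.

Lemma turn_path_ok_v s U : 0 < s <= 1 -> U <= 1 -> path_ok (F s) 0 U.
Proof.
move=> /andP[s0 s1] U1; split=> [t ht e e0|t ht]; last first.
  by apply: (@turn_nonzero 1 U) => //; rewrite ?s0 ?(ltW s0).
have [dl dl0 h] := path_cont_diff (@sarc_cont_le g 1 (lexx _)) (sarc_cont_le d U1)
   (s := s) (t := t) ltac:(by rewrite (ltW s0)) ht e0.
by exists dl => // x hx xt; apply: h => //; rewrite ?(ltW s0)// subrr normr0.
Qed.

Lemma turn_path_ok_h t S : 0 < t <= 1 -> S <= 1 -> path_ok (F ^~ t) 0 S.
Proof.
move=> /andP[t0 t1] S1; split=> [s hs e e0|s hs]; last first.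
  by apply: (@turn_nonzero S 1) => //; rewrite ?t0 ?orbT ?(ltW t0).
have [dl dl0 h] := path_cont_diff (sarc_cont_le g S1) (@sarc_cont_le d 1 (lexx _))
   (s := s) (t := t) hs ltac:(by rewrite (ltW t0)) e0.
by exists dl => // x hx xt; apply: h => //; rewrite ?(ltW t0)// subrr normr0.
Qed.

Lemma hit_turn (r a b : R) : 0 < r <= radius ->
  sarc g (hit g r) = polar r a -> sarc d (hit d r) = polar r b -> a < b < a + 2 * pi ->
  var (F (hit g r)) 0 (hit d r) - var (F ^~ (hit d r)) 0 (hit g r) = b - a - pi.
Proof.
move=> hr ea eb ab; have r0 : 0 < r by case/andP: hr.
have gg := hit_gt0 g hr; have dd := hit_gt0 d hr.
have g1 := hit_lt1 g hr; have d1 := hit_lt1 d hr.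
apply: (@corner_turn _ (sarc g) (sarc d) _ _ r) => //; rewrite ?(ltW gg) ?(ltW dd) ?sarc0//.
- by apply: turn_path_ok_v; rewrite ?gg ltW.
- by apply: turn_path_ok_h; rewrite ?dd ltW.
- by move=> s; apply: hit_le.
- by move=> s; apply: hit_le.
Qed.

Lemma F0l : F 0 = sarc d.
Proof. by apply: funext => t; rewrite /F sarc0 subr0. Qed.

Lemma var_F0r s S : 0 < s -> s <= S -> S <= 1 -> var (F ^~ 0) s S = var (sarc g) s S.
Proof.
move=> s0 sS S1.
have -> : F ^~ 0 = (fun t => - sarc g t) by apply: funext => t; rewrite /F sarc0 sub0r.
by apply: var_opp => //; apply: path_okW (sarc_ok g s0).
Qed.

Lemma turn_order (r a b : R) : 0 < r <= radius ->
  sarc g (hit g radius) = polar radius a -> sarc d (hit d radius) = polar radius b ->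
  a < b < a + 2 * pi ->
  a - angle_change g r < b - angle_change d r < a - angle_change g r + 2 * pi.
Proof.
move=> hr ea eb ab; have r0 : 0 < r by case/andP: hr.
have pi0 := pi_gt0 R.
have ear := sarc_hitE hr ea; have ebr := sarc_hitE hr eb.
set a' := a - _ in ear *; set b' := b - _ in ebr *.
(* [k] moves [b'] into the full turn that starts at [a']. Both circles then give a corner
   contribution by [hit_turn], and comparing them through [var_Lshape] forces the shift to be 0. *)
have [k hk] := angle_normalize a' b'.
have ebk : sarc d (hit d r) = polar r (b' + k%:~R * (2 * pi)) by rewrite polar_period.
set b'' := b' + _ in hk ebk.
have ne : b'' != a'.
  apply/eqP => e; have := @sarc_meet d g (hit g r) (hit d r) tt dg.
  rewrite ear ebk e subrr eqxx !hit_gt0// !ltW ?hit_gt0 ?hit_lt1//=.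
  by move=> /(_ isT isT isT).
have hk' : a' < b'' < a' + 2 * pi.
  by case/andP: hk => h1 h2; rewrite lt_neqAle eq_sym ne /=; apply/andP; split; lra.
have K1 := hit_turn radius_ok ea eb ab.
have K2 := hit_turn hr ear ebk hk'.
have := @var_Lshape _ F (hit g radius) (hit d radius) (hit g r) (hit d r).
rewrite !hit_gt0// !hit_mono// => /(_ isT isT) L.
have {}L := L (path_cont_diff (sarc_cont_le g (ltW (hit_lt1 g radius_ok)))
  (sarc_cont_le d (ltW (hit_lt1 d radius_ok)))) (fun x y => @turn_nonzero _ _ x y (ltW (hit_lt1 g radius_ok)) (ltW (hit_lt1 d radius_ok))).
move: L; rewrite K1 K2 F0l var_F0r ?hit_gt0 ?hit_mono//; last by rewrite ltW// hit_lt1.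
rewrite -/(angle_change g r) -/(angle_change d r) => L.
have : b'' = b' by rewrite /a' /b' in L *; lra.
by move=> <-.
Qed.

End Turn.

(* The angle swept by the arc of d seen from v; at its own endpoints the arc is cut at
   its first hit of the circle of radius [radius]. *)
Definition swing v d : R :=
  if v == tail d then var (sarc d) (hit d radius) 1
  else if v == head d then - var (sarc (rev d)) (hit (rev d) radius) 1
  else var (fun t => arc d t - pos G v) 0 1.

Lemma arc_ok d v : v != tail d -> v != head d -> path_ok (fun t => arc d t - pos G v) 0 1.
Proof.
move=> vt vh; split; first exact/path_contB/arc_cont.
move=> t ht; rewrite subr_eq0; apply/eqP => /(arc_hits_vertex ht).
by move=> [[_ /eqP]|[_ /eqP]]; apply/negP.
Qed.

Lemma swing_rev v d : swing v (rev d) = - swing v d.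
Proof.
rewrite /swing tail_rev head_rev revK.
have [->|vt] := eqVneq v (tail d); first by rewrite (negPf (tail_neq_head d)).
have [_|vh] := eqVneq v (head d); first by rewrite opprK.
rewrite -(var_rev ler01 (arc_ok vt vh)) subrr subr0.
apply: eq_var => //; first by apply: arc_ok; rewrite ?tail_rev ?head_rev.
by move=> t ht; rewrite arc_revE.
Qed.

Lemma swing_tail d : swing (tail d) d = var (sarc d) (hit d radius) 1.
Proof. by rewrite /swing eqxx. Qed.

Lemma swing_off v d : v != tail d -> v != head d ->
  swing v d = var (fun t => arc d t - pos G v) 0 1.
Proof. by rewrite /swing => /negPf -> /negPf ->. Qed.

(** This is [var_Lshape] on the whole square, with the corner at the common tail cut along the two
    first hits. The sides at parameter 1 are the swings seen from the heads, those at 0 the swings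
    seen from the tail. *)
Lemma swing_corner g d (a b : R) : tail d = tail g -> d != g ->
  sarc g (hit g radius) = polar radius a -> sarc d (hit d radius) = polar radius b ->
  a < b < a + 2 * pi ->
  swing (tail g) d - swing (head g) d + swing (head d) g - swing (tail d) g = pi - (b - a).
Proof.
move=> tt dg ea eb ab.
have hh : head g != head d by apply: contraNneq dg => e; apply/eqP/dart_eq.
have tg := tail_neq_head g; have td := tail_neq_head d.
rewrite -[in swing (tail g) d]tt [in swing (tail d) g]tt !swing_tail.
rewrite (@swing_off (head g) d)//; last by rewrite tt eq_sym.
rewrite (@swing_off (head d) g)//; [|by rewrite -tt eq_sym|by rewrite eq_sym].
have L := @var_Lshape _ (fun s t => sarc d t - sarc g s) 1 1 (hit g radius) (hit d radius).
have H e : 0 < hit e radius <= 1 by rewrite hit_gt0// ltW// hit_lt1.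
have {}L := L (H g) (H d)
  (path_cont_diff (sarc_cont_le g (lexx 1)) (sarc_cont_le d (lexx 1)))
  (fun x y => @turn_nonzero g d tt dg _ _ x y (lexx 1) (lexx 1)).
move: L; rewrite (hit_turn tt dg radius_ok ea eb ab) (F0l g d) var_F0r//; [|by case/andP: (H g)..].
have -> : (fun t => sarc d t - sarc g 1) = (fun t => arc d t - pos G (head g)).
  by apply: funext => t; rewrite /sarc arc1 tt opprB addrA subrK.
have -> : (fun s => sarc d 1 - sarc g s) = (fun s => - (arc g s - pos G (head d))).
  by apply: funext => t; rewrite /sarc arc1 tt !opprB addrA subrK.
rewrite (@var_opp _ (fun s => arc g s - pos G (head d)))//; last first.
  by apply: arc_ok; rewrite 1?eq_sym// -tt.
by move=> L; lra.
Qed.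

Lemma swing_disjoint g d : tail g != tail d -> tail g != head d -> head g != tail d ->
  head g != head d ->
  swing (tail g) d - swing (head g) d + swing (head d) g - swing (tail d) g = 0.
Proof.
move=> h1 h2 h3 h4; rewrite !swing_off// 1?eq_sym//.
pose F s t := arc d t - arc g s.
have ok : rect_ok F 0 1 0 1.
  split; first exact: path_cont_diff (arc_cont g) (arc_cont d).
  move=> s t hs ht; rewrite subr_eq0; apply/eqP => e.
  have gd : g != d by apply: contraNneq h1 => ->.
  have gr : g != rev d by apply: contraNneq h2 => ->; rewrite tail_rev.
  have [[t0|t1] [s0|s1]] := arc_meet gd gr ht hs e; move: e; rewrite ?t0 ?t1 ?s0 ?s1 ?arc0 ?arc1;
    move=> /(@pos_inj _ _ G)/eqP; rewrite eq_sym; exact/negP.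
have := var_rectangle ler01 ler01 ok.
have -> : F 0 = (fun t => arc d t - pos G (tail g)) by apply: funext => t; rewrite /F arc0.
have -> : F 1 = (fun t => arc d t - pos G (head g)) by apply: funext => t; rewrite /F arc1.
have -> : F ^~ 0 = (fun t => - (arc g t - pos G (tail d))) by apply: funext => t; rewrite /F arc0 opprB.
have -> : F ^~ 1 = (fun t => - (arc g t - pos G (head d))) by apply: funext => t; rewrite /F arc1 opprB.
rewrite (@var_opp _ (fun t => arc g t - pos G (tail d)))//; last by apply: arc_ok; rewrite eq_sym.
rewrite (@var_opp _ (fun t => arc g t - pos G (head d)))//; last by apply: arc_ok; rewrite eq_sym.
by lra.
Qed.

End Drawing.

Section Rotation.
Variables (R : realType) (T : finType) (G : plane_graph R T).
Local Notation dart := (dart G).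
Local Notation hrad := (radius_ok G).
Implicit Types (d g e : dart) (v : T).

Lemma angle_neq d g : tail d = tail g -> d != g -> angle d != angle g.
Proof.
move=> tt dg; apply/eqP => e.
have := @sarc_meet _ _ G d g (hit g (radius G)) (hit d (radius G)) tt dg.
rewrite !angleP e subrr eqxx !hit_gt0 ?hrad// !ltW ?hit_gt0 ?hit_lt1 ?hrad//=.
by move=> /(_ isT isT isT).
Qed.

(** * The rotation system *)

(** Values lie in ]0, 2 pi]: [ccw g g] is a full turn, hence the separate case in [corner]. *)
Definition ccw g d : R :=
  if angle g < angle d then angle d - angle g else angle d - angle g + 2 * pi.

Lemma ccw_itv g d : tail d = tail g -> d != g -> 0 < ccw g d < 2 * pi.
Proof.
move=> tt dg; have := angle_neq tt dg; rewrite /ccw.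
have /andP[? ?] := angle_itv g; have /andP[? ?] := angle_itv d.
by case: (ltgtP (angle g) (angle d)) => // h _; apply/andP; split; lra.
Qed.

Lemma ccw_sym g d : tail d = tail g -> d != g -> ccw g d + ccw d g = 2 * pi.
Proof.
by move=> tt dg; have := angle_neq tt dg; rewrite /ccw; case: (ltgtP (angle g) (angle d)) => // h _; lra.
Qed.

Lemma ccw_neq g d e : tail d = tail e -> d != e -> ccw g d != ccw g e.
Proof.
move=> tt de; have := angle_neq tt de; rewrite /ccw.
have /andP[? ?] := angle_itv g; have /andP[? ?] := angle_itv d; have /andP[? ?] := angle_itv e.
by move=> /eqP h; apply/eqP; case: (ltP (angle g) (angle d)) => ?; case: (ltP (angle g) (angle e)) => ? ?; apply: h; lra.
Qed.

Lemma ccw_add g d e : tail d = tail g -> tail e = tail g -> d != g -> e != g ->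
  ccw g d < ccw g e -> ccw g d + ccw d e = ccw g e.
Proof.
move=> td te dg eg; have := angle_neq td dg; have := angle_neq te eg; rewrite /ccw.
have /andP[? ?] := angle_itv g; have /andP[? ?] := angle_itv d; have /andP[? ?] := angle_itv e.
by case: (ltgtP (angle g) (angle e)) => // ? _; case: (ltgtP (angle g) (angle d)) => // ? _;
  case: (ltP (angle d) (angle e)) => ? ?; lra.
Qed.

Definition corner g d : R := if g == d then 0 else pi - ccw g d.

(** The turning of d(t) - g(s) along the four sides of the square, with the corners at shared
    endpoints cut off. *)
Definition pairing g d : R :=
  swing (tail g) d - swing (head g) d + swing (head d) g - swing (tail d) g.

Lemma pairing_revr g d : pairing g (rev d) = - pairing g d.
Proof. by rewrite /pairing !swing_rev tail_rev head_rev; lra. Qed.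

Lemma pairing_revl g d : pairing (rev g) d = - pairing g d.
Proof. by rewrite /pairing !swing_rev tail_rev head_rev; lra. Qed.

Lemma pairing_corner g d : tail d = tail g -> pairing g d = corner g d.
Proof.
move=> tt; rewrite /corner eq_sym; have [->|dg] := eqVneq d g.
  by rewrite /pairing; lra.
have := ccw_itv tt dg => /andP[c1 c2].
rewrite /pairing (swing_corner tt dg (angleP g) (b := angle g + ccw g d)).
- by lra.
- rewrite angleP /ccw; case: ifP => _; first by congr polar; lra.
  by rewrite -[in LHS](polar_period _ _ 1); congr polar; rewrite mulr1z; lra.
- by apply/andP; split; lra.
Qed.

(** Reversing darts turns any shared endpoint into a common tail. As the graph is simple, two shared
    endpoints mean that [d] is [g] or [rev g], and then the corner terms are 0. *)
Lemma pairingE g d : pairing g d =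
  corner g d *+ (tail d == tail g) - corner g (rev d) *+ (head d == tail g)
  - corner (rev g) d *+ (tail d == head g) + corner (rev g) (rev d) *+ (head d == head g).
Proof.
have nd := tail_neq_head d; have ng := tail_neq_head g.
have zero (a b : dart) : a = b -> corner a b = 0 by move=> ->; rewrite /corner eqxx.
have [tt|tt] := eqVneq (tail d) (tail g).
  rewrite [head d == tail g](_ : _ = false); last by rewrite -tt eq_sym (negPf nd).
  rewrite [tail d == head g](_ : _ = false); last by rewrite tt (negPf ng).
  rewrite (pairing_corner tt); have [hh|hh] := eqVneq (head d) (head g).
    have -> : d = g by apply: dart_eq.
    by rewrite (zero g g erefl) (zero (rev g) (rev g) erefl) !mulr0n !mulr1n; lra.
  by rewrite mulr1n !mulr0n; lra.
have [ht|ht] := eqVneq (head d) (tail g).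
  rewrite [head d == head g](_ : _ = false); last by rewrite ht (negPf ng).
  rewrite -[pairing g d]opprK -pairing_revr pairing_corner//.
  have [th|th] := eqVneq (tail d) (head g).
    have e : rev d = g by apply: dart_eq; rewrite ?tail_rev ?head_rev.
    by rewrite (zero g (rev d) (esym e)) (zero (rev g) d) -?e ?revK// !mulr0n !mulr1n; lra.
  by rewrite mulr1n !mulr0n; lra.
have [th|th] := eqVneq (tail d) (head g).
  rewrite [head d == head g](_ : _ = false); last by rewrite -th eq_sym (negPf nd).
  rewrite -[pairing g d]opprK -pairing_revl pairing_corner//.
  by rewrite mulr1n !mulr0n; lra.
have [hh|hh] := eqVneq (head d) (head g).
  rewrite -[pairing g d]opprK -pairing_revl -[pairing _ d]opprK -pairing_revr pairing_corner//.
  by rewrite mulr1n !mulr0n; lra.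
by rewrite /pairing swing_disjoint 1?eq_sym// !mulr0n; lra.
Qed.

Hypothesis deg2 : forall d, exists2 e, tail e = tail d & e != d.

Lemma exists_next d : exists e, [/\ tail e = tail d, e != d &
  forall e', tail e' = tail d -> e' != d -> ccw d e <= ccw d e'].
Proof.
have [e0 t0 n0] := deg2 d.
have P0 : (tail e0 == tail d) && (e0 != d) by rewrite t0 eqxx n0.
case: (@arg_minP _ _ _ e0 (fun e => (tail e == tail d) && (e != d)) (ccw d) P0) => e /andP[/eqP te ne] h; exists e; split=> // e' te' ne'.
by apply: h; rewrite te' eqxx ne'.
Qed.

Definition next d : dart := projT1 (cid (exists_next d)).

Lemma tail_next d : tail (next d) = tail d.
Proof. by rewrite /next; case: cid => e /= []. Qed.
Lemma next_neq d : next d != d.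
Proof. by rewrite /next; case: cid => e /= []. Qed.
Lemma ccw_next_le d e : tail e = tail d -> e != d -> ccw d (next d) <= ccw d e.
Proof. by rewrite /next; case: cid => ? /= [_ _ h]; apply: h. Qed.

Lemma ccw_next_lt d e : tail e = tail d -> e != d -> e != next d -> ccw d (next d) < ccw d e.
Proof.
move=> te ed en; rewrite lt_neqAle ccw_next_le// andbT ccw_neq// 1?eq_sym//.
by rewrite tail_next te.
Qed.

Lemma ccw_next g d : tail g = tail d -> g != d -> g != next d ->
  ccw g d + ccw d (next d) = ccw g (next d).
Proof.
move=> tt gd gn; have nd := next_neq d; have tn := tail_next d.
have := ccw_add tn tt nd gd (ccw_next_lt tt gd gn).
have := ccw_sym tt gd; have := @ccw_sym (next d) g; rewrite tn tt => /(_ erefl gn).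
by lra.
Qed.

(** If two darts [d] and [e] had the same successor, adding the angles from [d] to it and on to [e],
    and from [e] to it and on to [d], would give 4 pi = 2 pi. *)
Lemma next_inj : injective next.
Proof.
move=> d e de; apply/eqP/negPn/negP => ne.
have te : tail e = tail d by rewrite -(tail_next e) -de tail_next.
have n1 := next_neq d; have n2 : next d != e by rewrite de next_neq.
have t1 := tail_next d.
have := ccw_add t1 te n1 _ (ccw_next_lt te _ _); rewrite ![e == _]eq_sym ne n2 => /(_ isT isT isT) E1.
have := @ccw_add e (next d) d; rewrite t1 te => /(_ erefl erefl n2 ne).
rewrite [in ccw e _ < _]de => /(_ (ccw_next_lt _ _ _)).
rewrite te -de [d == next d]eq_sym n1 ne => /(_ erefl isT isT) E2.
have := ccw_sym t1 n1; have := @ccw_sym e (next d); rewrite t1 te => /(_ erefl n2).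
have := @ccw_sym e d; rewrite te => /(_ erefl ne).
have := pi_gt0 R; lra.
Qed.

Definition prev : dart -> dart := invF next_inj.
Lemma prevK : cancel prev next. Proof. exact: f_invF. Qed.
Lemma nextK : cancel next prev. Proof. exact: invF_f. Qed.
Lemma tail_prev d : tail (prev d) = tail d.
Proof. by rewrite -{2}(prevK d) tail_next. Qed.

(** The predecessor of [d] in the boundary walk of the face to the left of [d]; the orbits are the
    face walks. *)
Definition fprev d := rev (next d).
Lemma fprev_inj : injective fprev.
Proof. by move=> d e /(congr1 (@rev _ _ G)); rewrite !revK => /next_inj. Qed.

Section Potential.
Variables (n : dart -> R).
Let gam k := n (fprev k) - n k.
Hypothesis gam_rev : forall k, gam (rev k) = - gam k.
Let N k := n (fprev k).
Let m d := N d - N (prev d).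
Let X g := \sum_(d | tail d == tail g) m d * corner g d.
Let Z v := \sum_(k | tail k == v) N k * ccw k (next k).

Let N_prev d : N (prev d) = n (rev d).
Proof. by rewrite /N /fprev prevK. Qed.

Let m_rev d : m (rev d) = - m d.
Proof. by move: (gam_rev d); rewrite /m /gam !N_prev revK -!/(N _); lra. Qed.

Lemma sum_prev v (F : dart -> R) :
  \sum_(d | tail d == v) F (prev d) = \sum_(d | tail d == v) F d.
Proof.
rewrite (reindex_inj next_inj)/=; apply: eq_big => [d|d _]; first by rewrite tail_next.
by rewrite nextK.
Qed.

Lemma sum_rev (F : dart -> R) : \sum_d F (rev d) = \sum_d F d.
Proof. by rewrite [RHS](reindex_inj (inv_inj (@revK _ _ G))). Qed.

Lemma sum_delta v (F : dart -> R) g : tail g = v ->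
  \sum_(d | tail d == v) F d *+ (d == g) = F g.
Proof.
move=> tg; rewrite (bigD1 g) ?tg//= eqxx big1 ?addr0// => d /andP[_ /negPf ->].
by rewrite mulr0n.
Qed.

Let m_tail (f : T -> R) : \sum_d m d * f (tail d) = 0.
Proof.
rewrite (partition_big (@tail _ _ G) predT)//= big1// => v _.
rewrite (eq_bigr (fun d => m d * f v)) => [|d /eqP -> //].
by rewrite -mulr_suml sumrB (sum_prev v N) subrr mul0r.
Qed.

Let m_head (f : T -> R) : \sum_d m d * f (head d) = 0.
Proof.
rewrite -sum_rev (eq_bigr (fun d => - (m d * f (tail d)))) => [|d _].
  by rewrite sumrN m_tail oppr0.
by rewrite m_rev head_rev mulNr.
Qed.

(** Summation by parts around the tail of [g]. From [d] to [next d] the value of [corner g] drops by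
    [ccw d (next d)], except when one of the two is [g]: the convention [corner g g = 0] then
    contributes an extra - pi each time. *)
Let X_local g : X g - Z (tail g) = - pi * (N g + N (prev g)).
Proof.
have -> : X g = \sum_(d | tail d == tail g) N d * (corner g d - corner g (next d)).
  rewrite /X (eq_bigr (fun d => N d * corner g d - N (prev d) * corner g d)) => [|d _].
    2: by rewrite /m mulrBl.
  rewrite sumrB.
  rewrite [X in _ - X = _](eq_bigr (fun d => N (prev d) * corner g (next (prev d)))) => [|d _].
    2: by rewrite prevK.
  rewrite (sum_prev _ (fun d => N d * corner g (next d))) -sumrB.
  by apply: eq_bigr => d _; rewrite mulrBr.
rewrite -sumrB (eq_bigr (fun d => - pi * (N d *+ (d == g)) - pi * (N d *+ (d == prev g)))).
  by rewrite sumrB -!mulr_sumr !sum_delta ?tail_prev//; lra.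
move=> d /eqP td.
rewrite /corner ![g == _]eq_sym; have [->|dg] := eqVneq d g.
  rewrite (negPf (next_neq g)) [g == _](_ : _ = false); first by rewrite mulr0n mulr1n; lra.
  by apply/negP => /eqP e; have := next_neq g; rewrite {1}e prevK eqxx.
have [e|ng] := eqVneq (next d) g.
  have -> : (d == prev g) by rewrite -e nextK.
  have := @ccw_sym d g; rewrite td eq_sym dg => /(_ erefl isT).
  by rewrite e mulr0n mulr1n; nra.
have -> : (d == prev g) = false by apply/negP => /eqP e; move: ng; rewrite e prevK eqxx.
rewrite -(@ccw_next g d)// 1?eq_sym//; rewrite !mulr0n; lra.
Qed.

(* h v is the winding number around v of the chain of curves that follows each dart d on its
   left n d times, then crosses edges gam times to close up. *)
Lemma potential_exists : exists h : T -> R, forall g,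
  h (tail g) - h (head g) = - (2 * pi) * (n (fprev g) - n g).
Proof.
exists (fun v => 2^-1 * (\sum_d m d * swing v d) - Z v) => g.
have E : \sum_d m d * swing (tail g) d - \sum_d m d * swing (head g) d = 2 * (X g - X (rev g)).
  transitivity (\sum_d m d * pairing g d).
    (* The last two terms of [pairing] depend on [d] only through its head or its tail, and [m] has
       sum 0 over the darts at each vertex. *)
    have e1 := m_head (fun v => swing v g); have e2 := m_tail (fun v => swing v g).
    rewrite [RHS](eq_bigr (fun d => m d * swing (tail g) d - m d * swing (head g) d
      + m d * swing (head d) g - m d * swing (tail d) g)) => [|d _]; last first.
      by rewrite /pairing; ring.
    rewrite sumrB big_split /= sumrB e1 e2; lra.
  have S1 : \sum_d m d * (corner g d *+ (tail d == tail g)) = X g.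
    by rewrite /X [RHS]big_mkcond; apply: eq_bigr => d _; case: eqP => _; rewrite ?mulr1n ?mulr0n ?mulr0.
  have S2 : \sum_d m d * (corner (rev g) d *+ (tail d == head g)) = X (rev g).
    by rewrite /X [RHS]big_mkcond; apply: eq_bigr => d _; rewrite tail_rev; case: eqP => _; rewrite ?mulr1n ?mulr0n ?mulr0.
  have S3 : \sum_d m d * (corner g (rev d) *+ (head d == tail g)) = - X g.
    rewrite -S1 -[in LHS]sum_rev -sumrN; apply: eq_bigr => d _.
    by rewrite m_rev revK head_rev mulNr.
  have S4 : \sum_d m d * (corner (rev g) (rev d) *+ (head d == head g)) = - X (rev g).
    rewrite -S2 -[in LHS]sum_rev -sumrN; apply: eq_bigr => d _.
    by rewrite m_rev revK head_rev mulNr.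
  rewrite (eq_bigr _ (fun d _ => congr1 (fun x => m d * x) (pairingE g d))).
  rewrite (eq_bigr (fun d => m d * (corner g d *+ (tail d == tail g)) -
    m d * (corner g (rev d) *+ (head d == tail g)) -
    m d * (corner (rev g) d *+ (tail d == head g)) +
    m d * (corner (rev g) (rev d) *+ (head d == head g)))); last by move=> d _; ring.
  by rewrite big_split /= !sumrB S1 S2 S3 S4; lra.
have := X_local g; have := X_local (rev g); rewrite tail_rev !N_prev revK.
have := gam_rev g; rewrite /gam -!/(N _); nra.
Qed.

End Potential.
End Rotation.

(** * Euler's inequality by linear algebra *)

Section OrbitCounting.
Variables (D : finType) (f : D -> D).
Hypothesis f_inj : injective f.

(** Rows constant on the orbits of [f] factor through functions on the set of orbits. *)
Lemma rank_invariant (K : fieldType) m (M : 'M[K]_(m, #|D|)) :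
  (forall i k, M i (enum_rank (f k)) = M i (enum_rank k)) ->
  (\rank M <= #|froots f|)%N.
Proof.
move=> inv.
have invc i x y : fconnect f x y -> M i (enum_rank y) = M i (enum_rank x).
  move=> /iter_findex <-; elim: (findex f x y) => // n IH.
  by rewrite iterS inv.
pose A : 'M[K]_(m, #|froots f|) := \matrix_(i, r) M i (enum_rank (enum_val r)).
pose B : 'M[K]_(#|froots f|, #|D|) :=
  \matrix_(r, k) (enum_val r == froot f (enum_val k))%:R.
have -> : M = A *m B.
  apply/matrixP => i k; rewrite mxE.
  have rk : froot f (enum_val k) \in froots f.
    by apply: roots_root; apply: fconnect_sym.
  rewrite (bigD1 (enum_rank_in rk (froot f (enum_val k))))//= !mxE enum_rankK_in// eqxx mulr1.
  rewrite big1 ?addr0; last first.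
    move=> r ne; rewrite !mxE; case: eqP; rewrite ?mulr0// => e.
    by case/eqP: ne; apply: enum_val_inj; rewrite enum_rankK_in.
  by rewrite (invc i (enum_val k)) ?enum_valK// connect_root.
exact: leq_trans (mxrankM_maxr _ _) (rank_leq_row _).
Qed.

Lemma sum_orbits (w : D -> nat) : (forall x, w (f x) = w x) ->
  (\sum_x w x = \sum_(r in froots f) order f r * w r)%N.
Proof.
move=> inv.
have invc x y : fconnect f x y -> w y = w x.
  by move=> /iter_findex <-; elim: (findex f x y) => // n IH; rewrite iterS inv.
rewrite (partition_big (froot f) (mem (froots f))) /=; last first.
  by move=> x _; apply: roots_root; apply: fconnect_sym.
apply: eq_bigr => r rr.
rewrite (eq_bigr (fun _ => w r)) => [|x /eqP <-]; last by apply/esym/invc/connect_root.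
rewrite sum_nat_const; congr (_ * _)%N; apply: eq_card => x.
rewrite !inE [RHS](fconnect_sym f_inj) -(root_connect (fconnect_sym f_inj)).
by move/eqP: rr => ->.
Qed.

Lemma order_gt (k : nat) x : (forall i, (0 < i <= k)%N -> iter i f x != x) -> (k < order f x)%N.
Proof.
move=> h; rewrite ltnNge; apply/negP => le.
have := h (order f x); rewrite order_gt0 le iter_order// eqxx.
by move=> /(_ isT).
Qed.

End OrbitCounting.

Lemma card_darts (R : realType) (T : finType) (G : plane_graph R T) x :
  #|[pred e : dart G | tail e == x]| = deg G x.
Proof.
have /card_in_image <- : {in [pred e : dart G | tail e == x] &, injective (@head _ _ G)}.
  by move=> e g; rewrite !inE => /eqP te /eqP tg; apply: dart_eq; rewrite te.
apply: eq_card => y; apply/fintype.imageP/idP => [[e]|a].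
  by rewrite inE => /eqP te ->; rewrite unfold_in -te; exact: dart_adj.
by exists (exist _ (x, y) a : dart G); rewrite ?inE.
Qed.

Section Euler.
Variables (R : realType) (T : finType) (G : plane_graph R T).
Local Notation dart := (dart G).
Hypothesis deg2 : forall d : dart, exists2 e, tail e = tail d & e != d.
Variable x0 : T.
Local Notation next := (next deg2).
Local Notation fprev := (fprev deg2).
Implicit Types d e : dart.

Let sum_pick (n : nat) (v : 'I_n -> R) a : \sum_i v i * (i == a)%:R = v a.
Proof.
rewrite (bigD1 a)//= eqxx mulr1 big1 ?addr0// => i /negPf ->.
by rewrite mulr0.
Qed.

(** Functions on darts are row vectors. [K] consists of those whose increment along the face walks
    changes sign under [rev]; its codimension is at most the rank of [S], so at most the number of
    edges. By [potential_exists], [B] maps [K] into the differences of vertex functions, of rank at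
    most V - 1 since constants have no differences. The kernel of [B] is the space of functions
    constant on face walks. *)
Lemma dart_rank_bound : (#|dart| <= #|froots (@rev _ _ G)| + #|froots fprev| + #|T|.-1)%N.
Proof.
pose B : 'M[R]_#|dart| := \matrix_(i, j) ((i == enum_rank (fprev (enum_val j)))%:R - (i == j)%:R).
pose S : 'M[R]_#|dart| := \matrix_(i, j) ((i == j)%:R + (i == enum_rank (rev (enum_val j)))%:R).
pose C : 'M[R]_(#|T|, #|dart|) :=
  \matrix_(i, j) ((i == enum_rank (tail (enum_val j)))%:R - (i == enum_rank (head (enum_val j)))%:R).
have BE m (u : 'M[R]_(m, #|dart|)) i d :
    (u *m B) i (enum_rank d) = u i (enum_rank (fprev d)) - u i (enum_rank d).
  rewrite mxE; under eq_bigr do rewrite mxE mulrBr enum_rankK.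
  by rewrite sumrB !sum_pick.
have SE m (u : 'M[R]_(m, #|dart|)) i d :
    (u *m S) i (enum_rank d) = u i (enum_rank d) + u i (enum_rank (rev d)).
  rewrite mxE; under eq_bigr do rewrite mxE mulrDr enum_rankK.
  by rewrite big_split /= !sum_pick.
have CE (u : 'rV[R]_#|T|) d :
    (u *m C) 0 (enum_rank d) = u 0 (enum_rank (tail d)) - u 0 (enum_rank (head d)).
  rewrite mxE; under eq_bigr do rewrite mxE mulrBr enum_rankK.
  by rewrite sumrB !sum_pick.
have rS : (\rank S <= #|froots (@rev _ _ G)|)%N.
  apply: (rank_invariant (inv_inj (@revK _ _ G))) => i k.
  by rewrite !mxE !enum_rankK revK addrC.
have rB : (\rank (kermx B) <= #|froots fprev|)%N.
  apply: (rank_invariant (@fprev_inj _ _ G deg2)) => i k.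
  by apply/eqP; rewrite -subr_eq0 -BE mulmx_ker mxE.
have rC : (\rank C <= #|T|.-1)%N.
  have : ((const_mx 1 : 'rV[R]_#|T|) <= kermx C)%MS.
    apply/sub_kermxP; apply/rowP => j; rewrite -[j]enum_valK CE !mxE subrr//.
  move=> /mxrankS; rewrite mxrank_ker.
  have -> : \rank (const_mx 1 : 'rV[R]_#|T|) = 1%N.
    rewrite rank_rV; case: eqP => // /rowP/(_ (enum_rank x0)); rewrite !mxE => /eqP.
    by rewrite oner_eq0.
  by have := rank_leq_row C; lia.
pose K := kermx (B *m S).
have KB : (K *m B <= C)%MS.
  apply/row_subP => i; rewrite row_mul; set u := row i K.
  pose n d := u 0 (enum_rank d).
  have uBS : u *m B *m S = 0 by rewrite -mulmxA -row_mul mulmx_ker row0.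
  have gam d : n (fprev (rev d)) - n (rev d) = - (n (fprev d) - n d).
    have := SE _ (u *m B) 0 d; rewrite uBS mxE !BE -!/(n _) => e.
    by apply/eqP; rewrite -addr_eq0 addrC -e.
  have [h hh] := potential_exists gam.
  pose w : 'rV[R]_#|T| := \row_i ((- (2 * pi))^-1 * h (enum_val i)).
  suff -> : u *m B = w *m C by apply: submxMl.
  have wE t : w 0 (enum_rank t) = (- (2 * pi))^-1 * h t by rewrite mxE enum_rankK.
  apply/rowP => j; rewrite -[j]enum_valK BE CE !wE -mulrBr hh.
  have nz : - (2 * pi) != 0 :> R by rewrite oppr_eq0 mulf_neq0 ?pnatr_eq0// gt_eqF// pi_gt0.
  by rewrite mulKf.
have l1 := mxrankS KB; have l2 := mxrank_mul_ker K B.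
have l3 := mxrankS (capmxSr K (kermx B)).
have l4 := mxrankM_maxr B S; have l5 := rank_leq_row (B *m S).
have l6 : \rank K = (#|dart| - \rank (B *m S))%N := mxrank_ker _.
move: l1 l2 l3 l4 l5 l6 rB rC rS.
move: (\rank _) (\rank _) (\rank _) (\rank _) (\rank _) (\rank _) (\rank _) => *.
by lia.
Qed.

Definition triangular d := iter 3 fprev d == d.

Lemma triangular_fprev d : triangular (fprev d) = triangular d.
Proof. by rewrite /triangular -iterSr (inj_eq (@fprev_inj _ _ G deg2)). Qed.

Lemma euler_triangular :
  (2 * #|dart| + #|[pred d | ~~ triangular d]| < 12 * #|T|)%N.
Proof.
have revi := inv_inj (@revK _ _ G); have fi := @fprev_inj _ _ G deg2.
have E := dart_rank_bound.
have A : (2 * #|froots (@rev _ _ G)| <= #|dart|)%N.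
  have := sum_orbits revi (w := fun _ => 1%N) (fun _ => erefl).
  rewrite sum1_card => ->; rewrite -sum1_card big_distrr /=.
  apply: leq_sum => r _; rewrite !muln1; apply: order_gt => // -[|[|i]]//= _.
  exact: rev_neq.
have f1 d : fprev d != d.
  apply/eqP => /(congr1 (@tail _ _ G)); rewrite tail_rev => e.
  by have := tail_neq_head (next d); rewrite e tail_next eqxx.
have f2 d : iter 2 fprev d != d.
  apply/eqP => /= e; have e1 : next (fprev d) = rev d.
    by rewrite -[RHS](congr1 (@rev _ _ G) e) revK.
  have := next_neq deg2 d; case/eqP; apply: dart_eq; first by rewrite tail_next.
  by have := tail_next deg2 (fprev d); rewrite e1 !tail_rev.
(* Face by face: 12 = 4 * 3 for a triangle, and 12 + k <= 4k for a face walk of length k >= 4.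
   Lengths 1 and 2 are excluded by [f1] and [f2]. *)
have B : (12 * #|froots fprev| + #|[pred d | ~~ triangular d]| <= 4 * #|dart|)%N.
  have := sum_orbits fi (w := fun _ => 1%N) (fun _ => erefl); rewrite sum1_card => ->.
  have := sum_orbits fi (w := fun d => ~~ triangular d : nat) (fun d => congr1 (fun b => ~~ b : nat) (triangular_fprev d)).
  have -> : #|[pred d | ~~ triangular d]| = (\sum_d (~~ triangular d : nat))%N.
    by rewrite -sum1_card big_mkcond; apply: eq_bigr => d _; rewrite inE; case: ifP.
  move=> ->; rewrite -sum1_card !big_distrr -big_split /=.
  apply: leq_sum => r _; rewrite !muln1.
  have o2 : (2 < order fprev r)%N by apply: order_gt => // -[|[|[|i]]] //= _; exact: f2.
  case: (boolP (triangular r)) => t /=; rewrite ?muln0 ?muln1; first by lia.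
  suff : (3 < order fprev r)%N by lia.
  apply: order_gt => // -[|[|[|[|i]]]] //= _; exact: f2.
have V0 : (0 < #|T|)%N by apply/card_gt0P; exists x0.
by lia.
Qed.

(** Among the darts reached from [d], take one with the smallest angle to [e]. If it is not [e], its
    successor does not pass [e], so it is reached as well and lies closer. *)
Lemma next_connect d e : tail d = tail e -> fconnect next d e.
Proof.
move=> te; apply/negPn/negP => nc.
have P0 : fconnect next d d by apply: connect0.
case: (@arg_minP _ _ _ d (fun g => fconnect next d g) (fun g => ccw g e) P0) => g cg min.
have tc g' : fconnect next d g' -> tail g' = tail d.
  by move=> /iter_findex <-; elim: (findex _ _ _) => // n IH; rewrite iterS tail_next.
have tg := tc g cg.
have cn : fconnect next d (next g) by apply: (connect_trans cg); apply: fconnect1.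
have eg : e != g by apply: contraNneq nc => ->.
have en : e != next g by apply: contraNneq nc => ->.
have teg : tail e = tail g by rewrite tg.
have := ccw_add (tail_next deg2 g) teg (next_neq deg2 g) eg (ccw_next_lt teg eg en).
have := min _ cn; have := ccw_itv (tail_next deg2 g) (next_neq deg2 g) => /andP[+ _].
by lra.
Qed.

Lemma order_next d : order next d = deg G (tail d).
Proof.
rewrite -card_darts; apply: eq_card => e; rewrite !inE; apply/idP/eqP => [|te]; last exact: next_connect.
by move=> /iter_findex <-; elim: (findex _ _ _) => // n IH; rewrite iterS tail_next.
Qed.

Lemma next_counterclockwise d n : n = deg G (tail d) ->
  counterclockwise G (tail d) (fun i : 'I_n => head (iter i next d)).
Proof.
rewrite -order_next => ->.
pose dd (i : nat) := iter i next d.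
have tdd i : tail (dd i) = tail d by rewrite /dd; elim: i => // i; rewrite iterS tail_next.
have dd_inj i j : (i < order next d)%N -> (j < order next d)%N -> dd i = dd j -> i = j.
  by move=> hi hj e; rewrite -(findex_iter hi) -(findex_iter hj) -/(dd i) e.
(* The case [i = 0] is separate because [ccw d d] is 2 pi and not 0. *)
pose off i := if i == 0%N then 0 else ccw d (dd i).
have n0 i : (0 < i < order next d)%N -> dd i != d.
  by move=> /andP[i0 hi]; apply/eqP => e; have := dd_inj i 0%N hi (order_gt0 _ _) e; lia.
have offS i : (i.+1 < order next d)%N -> off i < off i.+1.
  move=> hi; rewrite /off /=; have h1 : dd i.+1 != d by apply: n0; rewrite hi.
  case: eqP => [_|/eqP i0]; first by have /andP[] := ccw_itv (tdd i.+1) h1.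
  have h0 : dd i != d by apply: n0; rewrite lt0n i0 (ltn_trans _ hi).
  have := ccw_next (deg2 := deg2) (d := dd i) (g := d); rewrite tdd eq_sym h0 => /(_ erefl isT).
  rewrite -[next (dd i)]/(dd i.+1) eq_sym h1 => /(_ isT).
  have := ccw_itv (tail_next deg2 (dd i)) (next_neq deg2 (dd i)) => /andP[+ _].
  by rewrite -[next (dd i)]/(dd i.+1); lra.
have off_lt i j : (i < j)%N -> (j < order next d)%N -> off i < off j.
  elim: j => // j IH; rewrite ltnS leq_eqVlt => /orP[/eqP -> | ij] hj; first exact: offS.
  by apply: lt_trans (offS _ hj); apply: IH => //; rewrite (ltn_trans _ hj).
have off_2pi i : (i < order next d)%N -> 0 <= off i < 2 * pi.
  move=> hi; rewrite /off; case: eqP => [_|/eqP i0].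
    by rewrite lexx; have := pi_gt0 R; lra.
  by have /andP[/ltW -> ->] := ccw_itv (tdd i) (n0 i ltac:(by rewrite lt0n i0)).
have offP i : (i < order next d)%N ->
    sarc (dd i) (hit (dd i) (radius G)) = polar (radius G) (angle d + off i).
  move=> hi; rewrite angleP /off; case: eqP => [->|_]; first by rewrite addr0.
  rewrite /ccw; case: ifP => _; first by congr polar; lra.
  by rewrite -[in LHS](polar_period _ _ 1); congr polar; rewrite mulr1z; lra.
rewrite /counterclockwise; near=> r.
have hr : 0 < r <= radius G.
  apply/andP; split; first by near: r; exact: nbhs_right_gt.
  by near: r; apply: nbhs_right_le; exact: radius_gt0.
pose a (i : nat) := angle d + off i - angle_change (dd i) r.
have ord i j : (i < j)%N -> (j < order next d)%N -> a i < a j < a i + 2 * pi.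
  move=> ij hj; have hi := ltn_trans ij hj.
  apply: turn_order => //; rewrite ?tdd ?offP//.
    by apply/eqP => e; have := dd_inj _ _ hj hi e; lia.
  have := off_lt _ _ ij hj; have /andP[? ?] := off_2pi _ hi; have /andP[? ?] := off_2pi _ hj.
  by move=> ?; apply/andP; split; lra.
exists a; split=> [i|i j ij|i j].
- have hi := ltn_ord i; have [/andP[h0 h1] _ lt] := hitP (dd i) hr.
  have earc : edge_arc G (tail d) (head (iter i next d)) = arc (dd i) by rewrite /arc tdd.
  have sE t : arc (dd i) t = sarc (dd i) t + pos G (tail d) by rewrite /sarc tdd subrK.
  exists (hit (dd i) r); rewrite earc; split.
  + by rewrite !ltW.
  + by rewrite sE (sarc_hitE hr (offP _ hi)) /circle_point /polar /= ![_ + r * _]addrC.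
  + move=> s b hs e; have := lt s hs.
    have -> : sarc (dd i) s = polar r b.
      rewrite /sarc tdd e /circle_point /polar [pos G _]surjective_pairing /=.
      by apply/pair_equal_spec; split; rewrite /=; ring.
    by rewrite dot_polar_self ltxx.
- by have /andP[] := ord i j ij (ltn_ord j).
- have := pi_gt0 R => pi0; have [ij|ji|/val_inj ->] := ltngtP i j; last lra.
    by have /andP[] := ord i j ij (ltn_ord j).
  by have /andP[] := ord j i ji (ltn_ord i); lra.
Unshelve. all: by end_near.
Qed.

End Euler.

End Drawings.

(** * From classes and darts back to stars *)

Lemma degree_class_le m n : m \in [:: 5; 6; 7; 8; 9; 10; 11; 12; 14; 15; 17; 35] ->
  degree_class n <= degree_class m -> n <= m.
Proof.
have mono a b : a <= b -> degree_class a <= degree_class b.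
  by move=> ab; apply: sub_count => k; move/leq_trans; apply.
move=> mL; apply: contraTT; rewrite -!ltnNge => mn.
(* Each bound [m] that occurs in the stars is the largest degree of its class, so the class
   increases from [m] to [m.+1]. *)
apply: (@leq_trans (degree_class m.+1)); last exact: mono.
by move: mL; rewrite !inE; do 11?[case/orP => [/eqP -> //|]]; move/eqP => ->.
Qed.

Lemma deg_le_class m n k : m \in [:: 5; 6; 7; 8; 9; 10; 11; 12; 14; 15; 17; 35] ->
  degree_class m = k -> degree_class n <= k -> deg_le n m.
Proof. by move=> mL <-; apply: degree_class_le. Qed.

Section StarsFromDarts.
Variables (R : realType) (T : finType) (G : plane_graph R T).
Hypothesis deg2 : forall d : dart G, exists2 e, tail e = tail d & e != d.
Local Notation next := (next deg2).
Variable d : dart G.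
Hypothesis deg5 : deg G (tail d) = 5.

Lemma iter_next_inj (e : dart G) i j : tail e = tail d -> i < 5 -> j < 5 ->
  head (iter i next e) = head (iter j next e) -> i = j.
Proof.
move=> te hi hj h; have o5 : order next e = 5 by rewrite order_next te.
have tn k : tail (iter k next e) = tail e by elim: k => // k; rewrite iterS tail_next.
have e1 : iter i next e = iter j next e by apply: dart_eq; rewrite ?tn.
by rewrite -(@findex_iter _ next e i) ?o5// e1 findex_iter ?o5.
Qed.

Lemma has_star_next (k : 'I_5 -> bound) e : tail e = tail d ->
  (forall i : 'I_5, deg_le (deg G (head (iter i next e))) (k i)) ->
  has_star G (k 0%R) (k 1%R) (k 2%:R%R) (k 3%:R%R) (k 4%:R%R).
Proof.
move=> te h; exists (tail e), (fun i => head (iter i next e)).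
have tn j : tail (iter j next e) = tail e by elim: j => // j; rewrite iterS tail_next.
split=> //.
- by rewrite te.
- by move=> i j /(iter_next_inj te (ltn_ord i) (ltn_ord j))/val_inj.
- by move=> i; rewrite -(tn i); exact: dart_adj.
- by left; apply: next_counterclockwise; rewrite te.
- move=> i; have := h i; case: i => [[|[|[|[|[|i]]]]] hi] //=;
  by congr (deg_le _ (k _)); apply: val_inj.
Qed.

Lemma has_star_prev (k : 'I_5 -> bound) e : tail e = tail d ->
  (forall i : 'I_5, deg_le (deg G (head (iter (4 - i) next e))) (k i)) ->
  has_star G (k 0%R) (k 1%R) (k 2%:R%R) (k 3%:R%R) (k 4%:R%R).
Proof.
move=> te h; exists (tail e), (fun i : 'I_5 => head (iter (4 - i) next e)).
have tn j : tail (iter j next e) = tail e by elim: j => // j; rewrite iterS tail_next.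
have sub4 (i : 'I_5) : 4 - i < 5 by rewrite ltnS leq_subr.
split=> //.
- by rewrite te.
- move=> i j /(iter_next_inj te (sub4 i) (sub4 j)) ij; apply: val_inj => /=.
  by have := ltn_ord i; have := ltn_ord j; lia.
- by move=> i; rewrite -(tn (4 - i)); exact: dart_adj.
- right; have := @next_counterclockwise _ _ _ deg2 e 5; rewrite te => /(_ (esym deg5)).
  rewrite (_ : (fun i : 'I_5 => head (iter (4 - rev_ord i) next e)) =
    (fun i : 'I_5 => head (iter i next e)))//.
  by apply: funext => i /=; congr (head (iter _ _ _)); have := ltn_ord i; lia.
- move=> i; have := h i; case: i => [[|[|[|[|[|i]]]]] hi] //=;
  by congr (deg_le _ (k _)); apply: val_inj.
Qed.

Let c (e : dart G) := degree_class (deg G (head e)).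

Lemma below_has_star (s0 s1 s2 s3 s4 : nat) (k0 k1 k2 k3 k4 : bound) :
  (forall n, degree_class n <= s0 -> deg_le n k0) ->
  (forall n, degree_class n <= s1 -> deg_le n k1) ->
  (forall n, degree_class n <= s2 -> deg_le n k2) ->
  (forall n, degree_class n <= s3 -> deg_le n k3) ->
  (forall n, degree_class n <= s4 -> deg_le n k4) ->
  let s := (s0, s1, s2, s3, s4) in
  let c0 := c d in let c1 := c (next d) in let c2 := c (next (next d)) in
  let c3 := c (next (next (next d))) in let c4 := c (next (next (next (next d)))) in
  rotations_below s c0 c1 c2 c3 c4 || rotations_below s c0 c4 c3 c2 c1 ->
  has_star G k0 k1 k2 k3 k4.
Proof.
move=> h0 h1 h2 h3 h4 s c0 c1 c2 c3 c4.
have cyc : next (next (next (next (next d)))) = d.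
  by move: (iter_order (@next_inj _ _ _ deg2) d); rewrite order_next deg5 => e; exact: e.
pose k (i : 'I_5) := tnth [tuple k0; k1; k2; k3; k4] i.
have F e : tail e = tail d ->
    below s (c e) (c (next e)) (c (next (next e))) (c (next (next (next e))))
      (c (next (next (next (next e))))) -> has_star G k0 k1 k2 k3 k4.
  move=> te /and5P[b0 b1 b2 b3 b4]; apply: (has_star_next (k := k) te).
  by case=> [[|[|[|[|[|i]]]]] hi] //; rewrite /k /tnth /=; [apply: h0|apply: h1|apply: h2|apply: h3|apply: h4].
have B e : tail e = tail d ->
    below s (c (next (next (next (next e))))) (c (next (next (next e)))) (c (next (next e)))
      (c (next e)) (c e) -> has_star G k0 k1 k2 k3 k4.
  move=> te /and5P[b0 b1 b2 b3 b4]; apply: (has_star_prev (k := k) te).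
  by case=> [[|[|[|[|[|i]]]]] hi] //; rewrite /k /tnth /=; [apply: h0|apply: h1|apply: h2|apply: h3|apply: h4].
have t1 := tail_next deg2 d; have t2 := tail_next deg2 (next d).
have t3 := tail_next deg2 (next (next d)); have t4 := tail_next deg2 (next (next (next d))).
rewrite t1 in t2; rewrite t2 in t3; rewrite t3 in t4.
have F0 := F _ erefl; have F1 := F _ t1; have F2 := F _ t2; have F3 := F _ t3; have F4 := F _ t4.
have B0 := B _ erefl; have B1 := B _ t1; have B2 := B _ t2; have B3 := B _ t3; have B4 := B _ t4.
rewrite !cyc in F1 F2 F3 F4 B1 B2 B3 B4.
by case/orP => /or4P[|||/orP[|]].
Qed.

End StarsFromDarts.

Theorem theorem1 (R : realType) (T : finType) (G : plane_graph R T) :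
  min_degree G 5 ->
  let S (k1 k2 k3 k4 k5 : bound) := has_star G k1 k2 k3 k4 k5 in
  S 5 7 7 5 17 \/ S 5 7 8 5 11 \/ S 5 7 5 8 8 \/
  S 8 5 5 11 6 \/ S 8 5 5 8 7 \/ S 8 5 5 7 8 \/
  S 8 5 5 6 9 \/ S 5 6 5 8 11 \/ S 5 6 6 5 Infty \/
  S 5 6 6 6 17 \/ S 6 6 6 6 11 \/ S 6 6 6 7 8 \/
  S 6 6 7 6 8 \/ S 5 6 6 11 7 \/ S 5 6 11 6 7 \/
  S 5 6 6 8 8 \/ S 5 6 8 6 8 \/ S 5 7 6 8 7 \/
  S 5 6 7 7 7 \/ S 5 6 6 7 11 \/ S 5 6 7 6 11 \/
  S 5 7 6 7 8 \/ S 5 7 7 6 8 \/ S 5 7 6 6 14 \/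
  S 5 8 6 6 11 \/ S 5 5 7 6 14 \/ S 5 6 7 5 35 \/
  S 5 6 8 5 15 \/ S 5 6 9 5 10 \/ S 5 6 11 5 9 \/
  S 5 5 10 5 12 \/ S 5 7 11 5 8 \/ S 5 6 5 7 14 \/
  S 5 5 9 5 17.
Proof.
move=> [mind [x0 _]] S; apply: contrapT => none.
have dg5 x : 5 <= #|[pred d : dart G | tail d == x]| by rewrite card_darts.
have deg2 (d : dart G) : exists2 e, tail e = tail d & e != d.
  have := dg5 (tail d); rewrite (cardD1 d) inE eqxx add1n ltnS => h.
  have /card_gt0P[e] : 0 < #|[predD1 [pred e : dart G | tail e == tail d] & d]| by apply: leq_trans h.
  by rewrite !inE => /andP[ne /eqP te]; exists e.
have phiK d : prev deg2 (rev (fprev deg2 d)) = d by rewrite /fprev revK nextK.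
have tri_next d : triangular deg2 d -> rev (next deg2 d) = prev deg2 (rev (prev deg2 (rev d))).
  by move=> /eqP /= e; rewrite -/(fprev deg2 d) -[in RHS]e !phiK.
have tri_prev d : triangular deg2 (prev deg2 (rev d)) = triangular deg2 d.
  have e : fprev deg2 (prev deg2 (rev d)) = d by rewrite /fprev prevK revK.
  by rewrite -{2}e triangular_fprev.
have E := euler_triangular deg2 x0.
have := discharging_contradiction (@revK _ _ G) (@tail_rev _ _ G) (nextK deg2) (prevK deg2)
  (tail_next deg2) (next_connect deg2) tri_next tri_prev dg5.
apply: wlog_neg => _; rewrite leqNgt E => h; exfalso; suff : false by [].
apply: h => d z; apply/negP => cov; apply: none.
have deg5 : deg G (tail d) = 5.
  by move/eqP: z; rewrite degree_class0 card_darts; have := mind (tail d); lia.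
move: cov; rewrite /view !card_darts /covered /stars.
have hasE A (a : pred A) x l : has a (x :: l) = a x || has a l by [].
(* One disjunct for each of the 34 entries of [stars], in the same order; the last one is left
   without a further disjunction. *)
do 33?[rewrite hasE => /orP[h|]; [left | move=> h; right; move: h]].
all: rewrite ?hasE ?orbF; try move=> h.
all: refine (below_has_star deg5 _ _ _ _ _ h) => n.
all: by [apply: deg_le_class |].
Qed.
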